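(* Let $n\ge 1$. (a) (Case of $\mathbb{Z}_N$.) Let $(x_t)_{t\ge0}$ be the multiline process with $n$ lines on $\mathbb{Z}_N$, started from a configuration in the domain $\mathcal{X}^{(N)}_*$ of $V^{(N)}$. Then the process $((V^{(N)}x_t)_n)_{t\ge0}$ (the $n$th line of $V^{(N)}x_t$) follows an $n$-type TASEP on $\mathbb{Z}_N$. (b) (Case of $\mathbb{Z}$.) Let $(x_t)_{t\ge0}$ be the multiline process with $n$ lines on $\mathbb{Z}$, such that almost surely $x_t\in\mathcal{X}_*$, the domain of $V$, for all $t\ge0$. Then the process $((Vx_t)_n)_{t\ge0}$ (the $n$th line of $Vx_t$) follows an $n$-type TASEP on $\mathbb{Z}$.
   Context: Let $\mathbb{L}$ be $\mathbb{Z}$ or the cycle $\mathbb{Z}_N$ (integers mod $N$). Write $\mathcal{U}_n=(\{1,\dots,n\}\cup\{\infty\})^{\mathbb{Z}}$ and $\mathcal{U}_n^{(N)}=(\{1,\dots,n\}\cup\{\infty\})^{\mathbb{Z}_N}$, with the order $1<\cdots<n<\infty$. For a configuration $u$ and a site $i$, $u^{(i-1,i)}$ agrees with $u$ off $\{i-1,i\}$ and has $u^{(i-1,i)}(i-1)=\min\{u(i-1),u(i)\}$, $u^{(i-1,i)}(i)=\max\{u(i-1),u(i)\}$. The $n$-type TASEP on $\mathbb{L}$ is the continuous-time Markov process on $\mathcal{U}_n$ (or $\mathcal{U}_n^{(N)}$) in which bells ring at each site as independent rate-1 Poisson processes and a bell at site $i$ replaces the current configuration $u$ by $u^{(i-1,i)}$.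 Multiline process. State space $\{1,\infty\}^{\mathbb{L}\times\{1,\dots,n\}}$; $x_m(i)$ is the value at site $i$ on line $m$, and $x_m$ is the $m$th line. For a state $x$ and site $i$ define $b_n=i$ and, for $m=n-1,\dots,1$, $b_m=b_{m+1}$ if $x_{m+1}(b_{m+1})=1$, $b_m=b_{m+1}+1$ if $x_{m+1}(b_{m+1})=\infty$. Let $Y(x,i)$ be the state whose $m$th line is $x_m^{(b_m-1,b_m)}$ for each $m$. Bells ring at each site of line $n$ as independent rate-1 Poisson processes, and when the bell at site $i$ of line $n$ rings, $x$ jumps to $Y(x,i)$. Queueing operator $F_m$ on $\mathbb{Z}$ ($m\ge1$). For $a\in\mathcal{U}_m$, $s\in\mathcal{U}_1$, $k\le m$, put $Q_j^{\le k}=\sup_{i\le j}\max\{0,\#\{l\in[i,j]:a(l)\le k\}-\#\{l\in[i,j]:s(l)=1\}\}$; $F_m(a,s)$ is defined when all $Q_j^{\le k}$ are finite. Then $d=F_m(a,s)\in\mathcal{U}_{m+1}$ is given by: $d(j)=\infty$ if $s(j)=\infty$; if $s(j)=1$, $d(j)$ is the smallest $k\in\{1,\dots,m\}$ with $Q_{j-1}^{\le k}>0$ or $a(j)\le k$ if such $k$ exists, and $d(j)=m+1$ otherwise. Collapse operator $F_m^{(N)}$ on $\mathbb{Z}_N$ ($m\ge1$). For $a\in\mathcal{U}_m^{(N)}$, $s\in\mathcal{U}_1^{(N)}$ put $\mathcal{A}_r=\{i:a(i)=r\}$ for $r\le m$, $\mathcal{S}=\{i:s(i)=1\}$, and assume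 $|\mathcal{A}_1\cup\cdots\cup\mathcal{A}_m|\le|\mathcal{S}|$. For $r=1,\dots,m$ successively, build $\mathcal{D}_r$ starting from $\emptyset$: take the sites $i\in\mathcal{A}_r$ one at a time in arbitrary order and for each add to $\mathcal{D}_r$ the first $j$ in the cyclic list $i,i+1,i+2,\dots$ such that $j\in\mathcal{S}\setminus(\mathcal{D}_1\cup\cdots\cup\mathcal{D}_{r-1})$ and $j$ is not yet in $\mathcal{D}_r$ (the result does not depend on the order). Let $\mathcal{D}_{m+1}=\mathcal{S}\setminus(\mathcal{D}_1\cup\cdots\cup\mathcal{D}_m)$. Then $d=F_m^{(N)}(a,s)\in\mathcal{U}_{m+1}^{(N)}$ has $d(i)=r$ if $i\in\mathcal{D}_r$ $(1\le r\le m+1)$ and $d(i)=\infty$ if $i\notin\mathcal{S}$. Maps $V$ and $V^{(N)}$. Given $x$, $v=Vx$ (on $\mathbb{Z}$) is defined by $v_1=x_1$, $v_{m+1}=F_m(v_m,x_{m+1})$ for $1\le m\le n-1$; $\mathcal{X}_*$ is the set of $x$ for which all these operations are defined. On $\mathbb{Z}_N$, $v=V^{(N)}x$ is defined by $v_1=x_1$, $v_{m+1}=F_m^{(N)}(v_m,x_{m+1})$; its domain $\mathcal{X}^{(N)}_*$ is the set of $x$ for which $\#\{i:x_m(i)=1\}$ is nondecreasing in $m$ (a condition preserved by the dynamics). *)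

(* Defs.v *)
From HB Require Import structures.
From mathcomp Require Import all_boot all_order all_algebra.
From mathcomp Require Import all_classical all_reals all_analysis.
Set Implicit Arguments.
Unset Strict Implicit.
Unset Printing Implicit Defensive.
Import Order.TTheory GRing.Theory Num.Theory.
Import numFieldNormedType.Exports.
Local Open Scope classical_set_scope.
Local Open Scope ring_scope.

(* {1, ..., n} U {oo} with 1 < ... < n < oo: the ordinal k < n stands for the
   class k+1, and ord_max (of value n) stands for oo.  In particular a particle
   of a {1, oo}-valued configuration is ord0 : U 1 and a hole is ord_max. *)
Definition U (n : nat) : finType := 'I_n.+1.

Definition infty {n} : U n := ord_max.
Definition particle : U 1 := ord0.

Section Dynamics.
(* A one-dimensional lattice, given by i |-> i - 1 and i |-> i + 1. *)
Variables (L : eqType) (prv nxt : L -> L).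

(* u^(i-1,i) *)
Definition sort_at n (u : L -> U n) (i : L) : L -> U n := fun j =>
  if j == i then Order.max (u (prv i) : 'I_n.+1) (u i)
  else if j == prv i then Order.min (u (prv i) : 'I_n.+1) (u i)
  else u j.

(* A state with n+1 lines; the paper's line m is indexed here by m - 1. *)
Definition mlstate n := 'I_n.+1 * L -> U 1.

Definition line n (x : mlstate n) (m : nat) : L -> U 1 :=
  fun i => x (inord m, i).

(* Position of the bell on the line that lies k lines below the top line n. *)
Fixpoint bell_pos n (x : mlstate n) (i : L) (k : nat) : L :=
  if k is k'.+1 then
    let b := bell_pos x i k' in
    if line x (n - k') b == particle then b else nxt b
  else i.

Definition mlbell n (x : mlstate n) (i : L) : mlstate n := fun c =>
  sort_at (line x c.1) (bell_pos x i (n - c.1)) c.2.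

Definition multiline_map (F : forall m, (L -> U m) -> (L -> U 1) -> L -> U m.+1)
    n (x : mlstate n) :=
  fix v (m : nat) : L -> U m.+1 :=
    if m is m'.+1 then F m'.+1 (v m') (line x m'.+1) else line x 0.

End Dynamics.

Section QueueZ.
Variable R : realType.

Definition prvZ (i : int) : int := i - 1.
Definition nxtZ (i : int) : int := i + 1.

(* #{l in [i, j] : p l}, for i <= j *)
Definition count_itv (p : pred int) (i j : int) : nat :=
  (\sum_(e < `|j - i|.+1) p (i + e%:Z)%R)%N.

(* With 0-based classes, this is the paper's Q_j^{<= k+1}. *)
Definition queue m (a : int -> U m) (s : int -> U 1) (k : nat) (j : int)
    : \bar R :=
  ereal_sup [set (Num.max 0
      ((count_itv (fun l => (a l <= k)%N) i j)%:R
       - (count_itv (fun l => s l == particle) i j)%:R))%:E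
    | i in [set i : int | i <= j]].

Definition FZ_defined m (a : int -> U m) (s : int -> U 1) : Prop :=
  forall k j, (k < m)%N -> queue a s k j \is a fin_num.

(* find returns m, i.e. the class m+1, when no k < m qualifies; the value m+1
   is oo in U m.+1. *)
Definition FZ m (a : int -> U m) (s : int -> U 1) : int -> U m.+1 := fun j =>
  if s j == particle then
    inord (find (fun k => (0 < queue a s k (j - 1))%E || (a j <= k)%N)
                (iota 0 m))
  else infty.

Definition VZ n (x : mlstate int n) (m : nat) : int -> U m.+1 :=
  multiline_map FZ x m.

Definition VZ_domain n (x : mlstate int n) : Prop :=
  forall m, (m < n)%N -> FZ_defined (VZ x m) (line x m.+1).

End QueueZ.

Section CollapseZN.
Variable N : nat.

(* First element of A in the cyclic list i, i+1, ..., i+N-1, if any. *)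
Definition first_from (A : {set 'I_N}) (i : 'I_N) : option 'I_N :=
  ohead [seq j <- traject (@ordS N) i N | j \in A].

(* Serve the sites of l successively, using the sites of A. *)
Definition serve (A : {set 'I_N}) (l : seq 'I_N) : {set 'I_N} :=
  foldl (fun D i =>
           if first_from (A :\: D) i is Some j then (j |: D)%SET else D)
        finset.set0 l.

Definition services (s : 'I_N -> U 1) : {set 'I_N} :=
  [set i | s i == particle]%SET.

(* The paper's D_1 U ... U D_r. *)
Fixpoint used m (a : 'I_N -> U m) (s : 'I_N -> U 1) (r : nat) : {set 'I_N} :=
  if r is r'.+1 then
    (used a s r' :|: serve (services s :\: used a s r')
                           (enum [set i | a i == r' :> nat]%SET))%SET
  else finset.set0.

(* D_(r+1) *)
Definition departures m (a : 'I_N -> U m) (s : 'I_N -> U 1) (r : nat)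
    : {set 'I_N} :=
  (used a s r.+1 :\: used a s r)%SET.

(* As for FZ, find returns m on the services that belong to no D_r, r <= m. *)
Definition FZN m (a : 'I_N -> U m) (s : 'I_N -> U 1) : 'I_N -> U m.+1 :=
  fun i =>
  if i \in services s then
    inord (find (fun r => i \in departures a s r) (iota 0 m))
  else infty.

Definition VZN n (x : mlstate 'I_N n) (m : nat) : 'I_N -> U m.+1 :=
  multiline_map FZN x m.

Definition VZN_domain n (x : mlstate 'I_N n) : Prop :=
  forall m, (m < n)%N ->
    (#|services (line x m)| <= #|services (line x m.+1)|)%N.

End CollapseZN.

Section Processes.
Variable R : realType.

Definition mutually_independent d (T : measurableType d) (P : probability T R)
    (I : choiceType) (G : I -> set (set T)) : Prop :=
  forall (s : seq I) (A : I -> set T), uniq s ->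
    (forall i, i \in s -> G i (A i)) ->
    P (\bigcap_(i in [set` s]) A i) = (\prod_(i <- s) P (A i))%E.

(* The counting process of a rate-1 Poisson process on [0, +oo[. *)
Definition poisson_process d (T : measurableType d) (P : probability T R)
    (N : R -> T -> nat) : Prop :=
  [/\ forall t, 0 <= t -> measurable_fun setT (N t),
      {ae P, forall w,
        [/\ N 0 w = 0%N,
            forall s t, 0 <= s -> s <= t -> (N s w <= N t w)%N
          & forall t, 0 <= t -> \forall s \near t^'+, N s w = N t w]},
      forall s t k, 0 <= s -> s < t ->
        P [set w | (N t w - N s w)%N = k] = (poisson_pmf (t - s) k)%:E
    & forall t : nat -> R, 0 <= t 0%N -> (forall k, t k <= t k.+1) ->
        mutually_independent P (fun k : nat =>
          [set A | exists B : set nat,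
             A = [set w | B (N (t k.+1) w - N (t k) w)%N]])].

Definition sigma_process d (T : measurableType d) (N : R -> T -> nat)
    : set (set T) :=
  <<s [set A | exists t k, 0 <= t /\ A = [set w | N t w = k]] >>.

Definition sigma_config (T C E : Type) (X : T -> C -> E) : set (set T) :=
  <<s [set A | exists c e, A = [set w | X w c = e]] >>.

Definition rings (N : R -> nat) (t : R) : Prop :=
  forall s, 0 <= s -> s < t -> (N s < N t)%N.

(* One path X, driven by the bells with counting functions N i.  The discrete
   product space C -> E makes left limits and right continuity coordinatewise;
   with infinitely many sites there need be no first bell.  The configuration
   just before time t is u. *)
Definition driven_by (I C E : Type) (upd : (C -> E) -> I -> C -> E)
    (N : I -> R -> nat) (X : R -> C -> E) : Prop :=
  (forall t c, 0 <= t -> \forall s \near t^'+, X s c = X t c) /\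
  (forall t, 0 < t -> exists u : C -> E,
    [/\ forall c, \forall s \near t^'-, X s c = u c,
        forall i, rings (N i) t -> X t = upd u i
      & (forall i, ~ rings (N i) t) -> X t = u]).

(* X (indexed by [0, +oo[) is a process with coordinate set C and finite value
   set E in which independent rate-1 Poisson bells, independent of X 0, ring at
   each i : I, and a bell at i replaces the current u by upd u i.  The bells
   may live on an extension pi : T' -> T of the probability space of X, so that
   following these dynamics is not tied to a given graphical construction. *)
Definition follows_bells d (T : measurableType d) (P : probability T R)
    (I : choiceType) (C : Type) (E : finType) (upd : (C -> E) -> I -> C -> E)
    (X : R -> T -> C -> E) : Prop :=
  (forall t c e, 0 <= t -> measurable [set w | X t w c = e]) /\
  exists (d' : measure_display) (T' : measurableType d')
         (P' : probability T' R) (pi : T' -> T) (N : I -> R -> T' -> nat),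
  [/\ measurable_fun setT pi /\
      (forall A, measurable A -> P' (pi @^-1` A) = P A),
      forall i, poisson_process P' (N i),
      mutually_independent P' (fun o : option I =>
        if o is Some i then sigma_process (N i)
        else sigma_config (fun w => X 0 (pi w)))
    & {ae P', forall w, driven_by upd (fun i t => N i t w)
                                      (fun t => X t (pi w))}].

Definition tasepZ d (T : measurableType d) (P : probability T R) n
    (X : R -> T -> int -> U n) : Prop :=
  follows_bells P (@sort_at int prvZ n) X.

Definition tasepZN d (T : measurableType d) (P : probability T R) N n
    (X : R -> T -> 'I_N -> U n) : Prop :=
  follows_bells P (@sort_at 'I_N (@ord_pred N) n) X.

Definition multilineZ d (T : measurableType d) (P : probability T R) n
    (X : R -> T -> mlstate int n) : Prop :=
  follows_bells P (@mlbell int prvZ nxtZ n) X.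

Definition multilineZN d (T : measurableType d) (P : probability T R) N n
    (X : R -> T -> mlstate 'I_N n) : Prop :=
  follows_bells P (@mlbell 'I_N (@ord_pred N) (@ordS N) n) X.

End Processes.

(* Main.v *)
(* A bell at site i of the top line sorts line m of the multiline state at the
   site b_m, and this makes the m-th line of V sorted at b_m as well, by
   induction on m.  The inductive step is a fact about one queue.  Merging the
   classes <= k turns the priority queue into a single-class queue governed by
   Lindley's recursion q(j) = (q(j-1) + a(j) - s(j))^+; sorting the arrivals
   and the services at neighbouring sites changes q at one site only and sorts
   the departures.  On the cycle the collapse operator is characterised by the
   periodic solutions of the recursion.

   On Z the queues look infinitely far to the left and there is no first bell.
   Removing all particles at sites <= l gives truncated states, to which the
   argument above applies, and V(x truncated at l) converges pointwise to V x
   as l -> -oo, by monotonicity.  Almost surely, up to any given time, there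
   are windows of n+2 silent sites arbitrarily far to the left and silent sites
   arbitrarily far to the right.  For l in silent windows the truncated images
   solve the same finite TASEP dynamics between two silent sites, so they agree
   there for all times once they agree at time 0.  Hence V x_t coincides locally
   with a truncated image, uniformly on compact time intervals. *)
Require Import Defs.
From mathcomp Require Import all_boot all_order all_algebra.
From mathcomp Require Import all_classical all_reals all_analysis.
From mathcomp Require Import zify ring lra.
Import Order.TTheory GRing.Theory Num.Theory.
Import numFieldNormedType.Exports.
Local Open Scope ring_scope.
Set Implicit Arguments.
Unset Strict Implicit.
Unset Printing Implicit Defensive.

(** * One bell at a priority queue *)

(** Classes are compared threshold by threshold, which reduces multi-class statements to
    single-class ones. Thresholds below [n] suffice because [infty] is the only value above all of
    them. *)
Lemma class_inj n (u v : U n) : (forall k, (k < n)%N -> (u <= k)%N = (v <= k)%N) -> u = v.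
Proof.
move=> uv; apply/val_inj/eqP => /=.
have := ltn_ord u; have := ltn_ord v; rewrite !ltnS => vn un.
rewrite eqn_leq; apply/andP; split.
  have [v_lt|] := ltnP v n; first by rewrite uv.
  by move=> /(leq_trans un).
have [u_lt|] := ltnP u n; first by rewrite -uv.
by move=> /(leq_trans vn).
Qed.

Lemma class_le n (u v : U n) :
  (forall k, (k < n)%N -> (v <= k)%N -> (u <= k)%N) -> (u <= v)%N.
Proof.
move=> uv; have [v_lt|nv] := ltnP v n; first exact: uv.
by apply: leq_trans nv; rewrite -ltnS.
Qed.

Lemma U1_le0 (a : U 1) : (a <= 0)%N = (a == particle).
Proof. by rewrite leqn0. Qed.

Section Lattice.
Variables (L : eqType) (prv nxt : L -> L).
Hypotheses (prvK : cancel prv nxt) (nxtK : cancel nxt prv).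

(** Merging classes commutes with sorting: below a threshold, max and min become conjunction and
    disjunction. A bell thus acts on each merged line as a single-class bell. *)
Lemma sort_at_le n (u : L -> U n) i k j :
  (sort_at prv u i j <= k)%N =
  if j == i then (u (prv i) <= k)%N && (u i <= k)%N
  else if j == prv i then (u (prv i) <= k)%N || (u i <= k)%N
  else (u j <= k)%N.
Proof.
rewrite /sort_at; case: ifP => _.
  by rewrite /Order.max ltEord; case: ifP => h; apply/idP/andP; lia.
case: ifP => _ //.
by rewrite /Order.min ltEord; case: ifP => h; apply/idP/orP; lia.
Qed.

Lemma sort_at_id n (u : L -> U n) i :
  (u (prv i) <= u i)%N -> sort_at prv u i = u.
Proof.
move=> le_u; apply/funext => j; rewrite /sort_at /Order.max /Order.min ltEord.
case: (altP (j =P i)) => [->|_]; last case: (altP (j =P prv i)) => [->|_] //.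
  by case: ifP => // h; apply/val_inj => /=; lia.
by case: ifP => // h; apply/val_inj => /=; lia.
Qed.

(* q j is the number of customers left after the possible service at j; the
   truncated subtraction is the positive part. *)
Definition lindley (a s : L -> nat) (q : L -> nat) :=
  forall j, q j = (q (prv j) + a j - s j)%N.

(* Stated through the queues of the customers of class <= k (0-based), which
   are required to be empty on E. *)
Definition queue_output (E : L -> Prop) m (a : L -> U m) (s : L -> U 1)
    (d : L -> U m.+1) : Prop :=
  (forall j, (d j <= m)%N = (s j == particle)) /\
  forall k, (k < m)%N -> exists q : L -> nat,
    [/\ lindley (fun j => (a j <= k)%N) (fun j => s j == particle) q,
        forall j, E j -> q j = 0%N &
        forall j, (d j <= k)%N
          = (s j == particle) && (0 < q (prv j) + (a j <= k)%N)%N].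

(** Two exchanged sites keep their total arrivals and services, so the queue changes only in
    between: at [prv i] if there is a service at [i], and at [i] otherwise. Both sites lie outside
    [E], so the queue stays empty there. *)
Lemma queue_output_bell (E : L -> Prop) m (a : L -> U m) s d i :
  ~ E i -> ~ E (prv i) -> queue_output E a s d ->
  queue_output E (sort_at prv a (if s i == particle then i else nxt i))
    (sort_at prv s i) (sort_at prv d i).
Proof.
move=> Ei Epi [dm dq].
(* At a fixed point of [prv], as on the one-site cycle, nothing moves. *)
have [pii|pii] := eqVneq (prv i) i.
  have nii : nxt i = i by rewrite -[in LHS]pii prvK.
  rewrite nii if_same !sort_at_id ?pii //.
have inj : injective prv := can_inj prvK.
have ppi : prv (prv i) != prv i by rewrite (inj_eq inj).
case: ifP => si; split.
- by move=> j; rewrite -U1_le0 !sort_at_le !dm !U1_le0.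
- move=> k km; have [q [ql qE dk]] := dq k km.
  have qi := ql i; have qpi := ql (prv i); have di := dk i; have dpi := dk (prv i).
  rewrite si /= in qi di.
  (* After sorting, [prv i] has a service for sure and its arrivals are the disjunction; the
     recursion dictates the value there. *)
  exists (fun j => if j == prv i then
    (q (prv (prv i)) + ((a (prv i) <= k)%N || (a i <= k)%N) - 1)%N else q j).
  split=> [j|j Ej|j] /=; rewrite -?U1_le0 ?sort_at_le ?U1_le0.
  + rewrite si andbT orbT (inj_eq inj).
    have [->|ji] := eqVneq j i.
      rewrite eq_sym (negbTE pii).
      by move: qi qpi; case: (a _ <= k)%N; case: (a _ <= k)%N; case: (s _ == _); lia.
    have [->|jpi] := eqVneq j (prv i); first by rewrite ?(negbTE pii) ?eqxx.
    exact: ql.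
  + by case: eqP => [jE|_]; [rewrite -jE in Epi | exact: qE].
  + rewrite si andbT orbT (inj_eq inj) di dpi.
    have [_|ji] := eqVneq j i.
      by move: qi qpi; case: (a _ <= k)%N; case: (a _ <= k)%N; case: (s _ == _); lia.
    have [->|jpi] := eqVneq j (prv i); last exact: dk.
    by move: qi qpi; case: (a _ <= k)%N; case: (a _ <= k)%N; case: (s _ == _); lia.
- by move=> j; rewrite -U1_le0 !sort_at_le !dm !U1_le0.
- move=> k km; have [q [ql qE dk]] := dq k km.
  have qi := ql i; have qni := ql (nxt i); have di := dk i; have dpi := dk (prv i).
  have dni := dk (nxt i).
  rewrite si /= in qi di; rewrite nxtK in qni dni.
  have nii : nxt i != i by rewrite -(inj_eq inj) nxtK eq_sym.
  (* Without a service at [i], services and departures are already in order, and the recursion at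
     [i] subtracts nothing. *)
  exists (fun j => if j == i then
    (q (prv i) + ((a i <= k)%N || (a (nxt i) <= k)%N))%N else q j).
  have sE j : (sort_at prv s i j == particle) = (s j == particle).
    rewrite -U1_le0 sort_at_le !U1_le0 si andbF orbF.
    by case: eqVneq => [->|_]; [rewrite si | case: eqVneq => [->|]].
  split=> [j|j Ej|j] /=; rewrite ?sE ?sort_at_le ?nxtK.
  + have [->|jni] := eqVneq j (nxt i).
      rewrite (negbTE nii) nxtK eqxx.
      by move: qi qni; case: (a _ <= k)%N; case: (a _ <= k)%N; case: (s _ == _); lia.
    have [->|ji] := eqVneq j i.
      by rewrite si (negbTE pii) subn0.
    have -> : (prv j == i) = false.
      by apply/negbTE; apply: contra jni => /eqP <-; rewrite prvK.
    exact: ql.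
  + by case: eqP => [jE|_]; [rewrite -jE in Ei | exact: qE].
  + rewrite di andbF orbF.
    have [->|ji] := eqVneq j i; first by rewrite si.
    have [->|jni] := eqVneq j (nxt i).
      have -> : (if nxt i == prv i then (d (prv i) <= k)%N else (d (nxt i) <= k)%N)
          = (d (nxt i) <= k)%N by case: eqVneq => [->|].
      rewrite nxtK eqxx dni.
      by move: qi qni; case: (a _ <= k)%N; case: (a _ <= k)%N; case: (s _ == _); lia.
    have -> : (prv j == i) = false.
      by apply/negbTE; apply: contra jni => /eqP <-; rewrite prvK.
    by rewrite -dk; case: eqVneq => [->|].
Qed.

Section MultilineBell.
Variables (F : forall m, (L -> U m) -> (L -> U 1) -> L -> U m.+1).
Variables (E : L -> Prop) (n : nat) (x : mlstate L n) (i : L).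
Let v := multiline_map F x.
Let x' := mlbell prv nxt x i.
Let v' := multiline_map F x'.

Lemma line_mlbell m : (m <= n)%N ->
  line x' m = sort_at prv (line x m) (bell_pos nxt x i (n - m)).
Proof. by move=> mn; apply/funext => j; rewrite /line /x' /mlbell /= inordK. Qed.

(** The operator enters only through [queue_output], so one induction serves both lattices: the
    sorted lines satisfy the relation for the new state, and uniqueness identifies the sorted output
    with the new line. *)
Lemma multiline_bell :
  (forall k, ~ E (bell_pos nxt x i k)) ->
  (forall k, ~ E (prv (bell_pos nxt x i k))) ->
  (forall m, (m < n)%N -> queue_output E (v m) (line x m.+1) (v m.+1)) ->
  (forall m, (m < n)%N -> forall d,
     queue_output E (v' m) (line x' m.+1) d -> d = v' m.+1) ->
  forall m, (m <= n)%N -> v' m = sort_at prv (v m) (bell_pos nxt x i (n - m)).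
Proof.
move=> Eb Epb vout v'uniq; elim=> [_|m IH mn].
  by rewrite /v' /= line_mlbell // subn0.
symmetry; apply: v'uniq => //.
rewrite IH ?line_mlbell ?(ltnW mn) //.
(* This shift lets [bell_pos] unfold once, exposing the test on line [m.+1] that decides whether the
   bell moves on. *)
have -> : (n - m = (n - m.+1).+1)%N by lia.
rewrite /= subKn //; apply: queue_output_bell => //; exact: vout.
Qed.

End MultilineBell.

End Lattice.

(** * The collapse operator on the cycle *)

Lemma find_iota_le_size m (p : pred nat) : (find p (iota 0 m) <= m)%N.
Proof. by rewrite -[X in (_ <= X)%N](size_iota 0 m) find_size. Qed.

Lemma find_iota_le m (p : pred nat) k : (k < m)%N ->
  (find p (iota 0 m) <= k)%N = has p (iota 0 k.+1).
Proof.
move=> km; rewrite -ltnS -has_take_leq ?size_iota //.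
by rewrite take_iota (minn_idPl km).
Qed.

Section Collapse.
Variable N : nat.
Implicit Types (i j : 'I_N) (A D : {set 'I_N}) (al : 'I_N -> nat).

Lemma val_iter_ordS t i : iter t (@ordS N) i = ((i + t) %% N)%N :> nat.
Proof.
elim: t => [|t IH] /=; first by rewrite addn0 modn_small.
by rewrite IH -addn1 modnDml -addnA addn1.
Qed.

Lemma traject_ordS_uniq i t : (t <= N)%N -> uniq (traject (@ordS N) i t).
Proof.
case: t => // t tN; rewrite looping_uniq; apply/trajectP => -[u ut].
move/(congr1 val); rewrite /= !val_iter_ordS => /eqP.
by rewrite eqn_modDl !modn_small 1?(ltn_trans ut) //; lia.
Qed.

Lemma map_traject (T : Type) (f : T -> T) x t :
  map f (traject f x t) = traject f (f x) t.
Proof. by elim: t x => //= t IH x; rewrite IH. Qed.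

Lemma mem_traject_ordS i j : j \in traject (@ordS N) i N.
Proof.
have /eqP : #|traject (@ordS N) i N| = #|{: 'I_N}|.
  by rewrite (card_uniqP (traject_ordS_uniq i (leqnn N))) size_traject card_ord.
rewrite (subset_leqif_card (subset_predT _)).2 => /fintype.subsetP.
exact.
Qed.

Lemma first_from_some A i j : first_from A i = Some j ->
  exists t, [/\ (t < N)%N, j = iter t (@ordS N) i, j \in A &
    forall k, k \in traject (@ordS N) i t -> k \notin A].
Proof.
suff fP n k : ohead [seq j <- traject (@ordS N) k n | j \in A] = Some j ->
  exists t, [/\ (t < n)%N, j = iter t (@ordS N) k, j \in A &
    forall k', k' \in traject (@ordS N) k t -> k' \notin A] by exact: fP.
elim: n k => //= n IH k.
case: ifP => [kA [<-]|kA]; first by exists 0%N.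
move=> /IH[t [tn -> tA kt]]; exists t.+1; split => //.
  by rewrite iterSr.
by move=> k'; rewrite /= inE => /predU1P[->|/kt//]; rewrite kA.
Qed.

Lemma first_from_none A i : first_from A i = None -> A = finset.set0.
Proof.
move=> Ai; apply/setP => j; rewrite finset.inE; apply/negbTE/negP => jA.
have : j \in [seq j <- traject (@ordS N) i N | j \in A].
  by rewrite mem_filter jA mem_traject_ordS.
by move: Ai; rewrite /first_from; case: [seq _ <- _ | _].
Qed.

(* al counts the arrivals at each site, and D is the set of used services. *)
Definition served (S : {set 'I_N}) al D := exists q : 'I_N -> nat,
  lindley (@ord_pred N) al (fun j => j \in S) q /\
  forall j, (j \in D) = (j \in S) && (0 < q (ord_pred j) + al j)%N.

(** Summing [q j + (j \in D) = q (ord_pred j) + al j] around the cycle cancels the queues. *)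
Lemma served_card S al D : served S al D -> #|D| = (\sum_j al j)%N.
Proof.
move=> [q [ql Dq]].
have : (\sum_j (q j + (j \in D)) = \sum_j (q (ord_pred j) + al j))%N.
  by apply: eq_bigr => j _; rewrite ql Dq; case: (j \in S) => /=; lia.
rewrite !big_split /= [X in _ = (X + _)%N -> _](_ : _ = \sum_j q j)%N.
  move=> /addnI <-; rewrite -sum1_card big_mkcond /=.
  by apply: eq_bigr => j _; case: (j \in D).
by rewrite [RHS](reindex_inj (can_inj (@ord_predK N))).
Qed.

(* The new customer lengthens the queue by one on its way from i to j0. *)
Lemma served_step S al D i j0 : served S al D ->
  first_from (S :\: D)%SET i = Some j0 ->
  served S (fun j => al j + (j == i))%N (j0 |: D)%SET.
Proof.
move=> [q [ql Dq]] /first_from_some[t [tN j0t j0A notA]].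
set B := traject (@ordS N) i t in notA.
(* [B] runs from [i] to just before [j0]. Appending [j0], or shifting [B] and putting [i] in front,
   gives the same arc: this is the balance equation of the added customer. *)
have shift j : ((j \in B) + (j == j0) = (ord_pred j \in B) + (j == i))%N.
  have : count_mem j (traject (@ordS N) i t.+1) = count_mem j (i :: map (@ordS N) B).
    by rewrite [X in _ = count _ X](_ : _ = traject (@ordS N) i t.+1) //= /B map_traject.
  rewrite [X in count _ X = _]trajectSr -j0t -cats1 count_cat /= addn0 -/B.
  rewrite count_uniq_mem ?traject_ordS_uniq // 1?ltnW //.
  rewrite count_uniq_mem; last first.
    by rewrite map_inj_uniq ?traject_ordS_uniq 1?ltnW //; exact: can_inj (@ordSK N).
  have -> : (j \in map (@ordS N) B) = (ord_pred j \in B).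
    by rewrite -[X in X \in map _ _]ord_predK mem_map //; exact: can_inj (@ordSK N).
  by rewrite (eq_sym j0) (eq_sym i) [RHS]addnC.
have uB : (j0 \in B) = false.
  by apply/negbTE/negP => /notA; rewrite j0A.
exists (fun j => q j + (j \in B))%N; split=> [j|j] /=.
  have := shift j; have /= := ql j; have := Dq j.
  have [->|jj0] := eqVneq j j0.
    move: j0A; rewrite finset.in_setD uB => /andP[/negbTE -> ->] /=; lia.
  case jB : (j \in B); last lia.
  have := notA _ jB; rewrite finset.in_setD negb_and negbK.
  by case: (j \in D); case: (j \in S) => //=; lia.
rewrite finset.in_setU1; have := shift j; have := Dq j.
have [->|jj0] := eqVneq j j0.
  move: j0A; rewrite finset.in_setD uB => /andP[/negbTE -> ->] /=; lia.
case jB : (j \in B).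
  have := notA _ jB; rewrite finset.in_setD negb_and negbK.
  by case: (j \in D); case: (j \in S) => //=; lia.
by move=> -> /=; case: (j \in S) => //=; lia.
Qed.

(** Customers are added one by one; the cardinality bound ensures that each finds a free service. *)
Lemma served_serve S al D0 l : served S al D0 ->
  (\sum_j al j + size l <= #|S|)%N ->
  served S (fun j => al j + count_mem j l)%N (D0 :|: serve (S :\: D0) l)%SET.
Proof.
rewrite /serve -[D0 in served _ _ D0 -> _](finset.setU0).
elim: l al (finset.set0) => [|i l IH] al D DS.
  by rewrite (_ : (fun _ => _) = al) //; apply/funext => j /=; rewrite addn0.
rewrite addnS => lS.
rewrite [foldl _ _ _]/=; case ff : (first_from _ i) => [j0|]; last first.
  (* A failed search would put all of [S] among the used services, which are only as many as the
     arrivals so far. *)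
  move/first_from_none: ff; rewrite finset.setDDl => /eqP; rewrite finset.setD_eq0.
  by move/subset_leq_card; rewrite (served_card DS); lia.
rewrite finset.setDDl in ff; have := served_step DS ff; rewrite finset.setUCA => /IH.
have sum1 : (\sum_j (j == i) = 1)%N.
  by rewrite (bigD1 i) //= eqxx big1 ?addn0 // => j /negbTE ->.
rewrite big_split /= sum1 -addnA add1n addnS => /(_ lS).
by congr (served _ _ _); apply/funext => j; rewrite (eq_sym i) addnA.
Qed.

Section Output.
Variables (m : nat) (a : 'I_N -> U m) (s : 'I_N -> U 1).

Lemma sum_class_card k : (\sum_j (a j < k)%N = #|[set j | (a j < k)%N]%SET|)%N.
Proof.
rewrite -sum1_card [RHS]big_mkcond /=.
by apply: eq_bigr => j _; rewrite finset.inE; case: ltnP.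
Qed.

(** Priorities disappear on merging: class [r] takes what the smaller classes left, so together they
    use the services that one merged class would use. *)
Lemma served_used : (#|[set j | (a j < m)%N]%SET| <= #|services s|)%N ->
  forall r, (r <= m)%N ->
  served (services s) (fun j => (a j < r)%N) (used a s r).
Proof.
move=> card_le; elim=> [_|r IH rm] /=.
  exists (fun=> 0%N); split=> j; first by rewrite add0n sub0n.
  by rewrite finset.inE andbF.
have /served_serve := IH (ltnW rm) => /(_ (enum [set i | a i == r :> nat]%SET)).
rewrite -cardE sum_class_card.
have -> : (#|[set j | (a j < r)%N]%SET| + #|[set i | a i == r :> nat]%SET|)%N
   = #|[set j | (a j < r.+1)%N]%SET|.
  rewrite -cardsUI [(_ :&: _)%SET](_ : _ = finset.set0) ?cards0 ?addn0.
    by congr #|pred_of_set _|; apply/setP => j; rewrite !finset.inE ltnS orbC -leq_eqVlt.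
  by apply/setP => j; rewrite !finset.inE; case: ltngtP.
have -> : (fun j => ((a j < r)%N + count_mem j (enum [set i | a i == r :> nat]%SET))%N)
   = (fun j => (a j < r.+1)%N : nat).
  apply/funext => j; rewrite count_uniq_mem ?enum_uniq // mem_enum finset.inE ltnS.
  by case: ltngtP.
apply; apply: leq_trans card_le; apply/subset_leq_card/fintype.subsetP => j.
by rewrite !finset.inE => /leq_trans; apply.
Qed.

Lemma used_sub r k : (r <= k)%N -> used a s r \subset used a s k.
Proof.
elim: k => [|k IH]; first by rewrite leqn0 => /eqP ->.
rewrite leq_eqVlt => /predU1P[->//|]; rewrite ltnS => /IH /fintype.subset_trans; apply.
exact: finset.subsetUl.
Qed.

Lemma FZN_le_max j : (FZN a s j <= m)%N = (s j == particle).
Proof.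
rewrite /FZN finset.inE; case: ifP => _ /=; last by rewrite ltnn.
by rewrite inordK ?ltnS ?leqW ?find_iota_le_size.
Qed.

Lemma FZN_le k j : (k < m)%N ->
  (FZN a s j <= k)%N = (s j == particle) && (j \in used a s k.+1).
Proof.
move=> km; rewrite /FZN finset.inE; case: ifP => _ /=; last by lia.
rewrite inordK ?ltnS ?leqW ?find_iota_le_size // find_iota_le //.
apply/hasP/idP => [[r]|].
  rewrite mem_iota /departures finset.in_setD add0n => rk /andP[_].
  have : used a s r.+1 \subset used a s k.+1 by apply: used_sub; lia.
  by move/fintype.subsetP; apply.
elim: (k) => [|k' IH] jk.
  by exists 0%N => //; rewrite /departures finset.in_setD finset.inE.
case jk' : (j \in used a s k'.+1).
  have [r] := IH jk'; rewrite mem_iota => rk rd; exists r => //.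
  by rewrite mem_iota; lia.
exists k'.+1; first by rewrite mem_iota; lia.
by rewrite /departures finset.in_setD jk' jk.
Qed.

Lemma FZN_output : (#|[set j | (a j < m)%N]%SET| <= #|services s|)%N ->
  queue_output (@ord_pred N) (fun=> False) a s (FZN a s).
Proof.
move=> card_le; split=> [j|k km]; first exact: FZN_le_max.
have [q [ql qd]] := served_used card_le km.
exists q; split=> // j; rewrite ?FZN_le //.
  by rewrite ql finset.inE.
by rewrite qd finset.inE andbA andbb.
Qed.

End Output.

Lemma eq_on_cycle (p : pred 'I_N) j :
  (forall i, p (ord_pred i) -> p i) -> p j -> forall i, p i.
Proof.
move=> step pj i; have /trajectP[t _ ->] := mem_traject_ordS j i.
by elim: t => //= t IH; apply: step; rewrite ordSK.
Qed.

(** Periodic solutions need not be unique (without arrivals and services any constant is one), but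
    the used services are. The recursion is monotone, so a comparison at one site spreads around the
    cycle. It gives one inclusion, and both sets have as many elements as there are arrivals. *)
Lemma lindley_served_uniq (S : {set 'I_N}) al q q' D D' :
  lindley (@ord_pred N) al (fun j => j \in S) q ->
  lindley (@ord_pred N) al (fun j => j \in S) q' ->
  (forall j, (j \in D) = (j \in S) && (0 < q (ord_pred j) + al j)%N) ->
  (forall j, (j \in D') = (j \in S) && (0 < q' (ord_pred j) + al j)%N) ->
  D = D'.
Proof.
wlog [j le_q] : q q' D D' / exists j, (q j <= q' j)%N.
  move=> wl ql q'l Dq D'q'; case: (pickP (fun j => (q j <= q' j)%N)) => [j le_q|no].
    by apply: (wl q q') => //; exists j.
  (* Here [q'] is below [q] everywhere, and the roles are exchanged; a cycle without sites is
     trivial. *)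
  case: (pickP (fun _ : 'I_N => true)) => [j _|none].
    symmetry; apply: (wl q' q) => //; exists j; apply: ltnW; rewrite ltnNge.
    exact/negbT/no.
  by apply/setP => j; have := none j.
move=> ql q'l Dq D'q'.
have {}le_q : forall i, (q i <= q' i)%N.
  apply: (@eq_on_cycle (fun i => (q i <= q' i)%N) j) => // i.
  by rewrite (ql i) (q'l i); lia.
apply/eqP; rewrite eqEcard; apply/andP; split.
  apply/fintype.subsetP => i; rewrite Dq D'q' => /andP[-> /=].
  by have := le_q (ord_pred i); lia.
have SD : served S al D by exists q.
have SD' : served S al D' by exists q'.
by rewrite (served_card SD) (served_card SD').
Qed.

Lemma queue_output_uniqN m (a : 'I_N -> U m) s d d' :
  queue_output (@ord_pred N) (fun=> False) a s d ->
  queue_output (@ord_pred N) (fun=> False) a s d' -> d = d'.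
Proof.
move=> [dm dq] [d'm d'q]; apply/funext => j; apply: class_inj => k.
rewrite ltnS leq_eqVlt => /predU1P[->|km]; first by rewrite dm d'm.
have [q [ql _ qd]] := dq k km; have [q' [q'l _ q'd]] := d'q k km.
have serviceE i : (i \in services s) = (s i == particle) by rewrite finset.inE.
have /setP/(_ j) : [set j | (d j <= k)%N]%SET = [set j | (d' j <= k)%N]%SET.
  apply: (@lindley_served_uniq (services s) (fun j => (a j <= k)%N) q q') => i;
    rewrite ?serviceE ?finset.inE //.
by rewrite !finset.inE.
Qed.

Section Multiline.
Variables (n : nat).
Implicit Type x : mlstate 'I_N n.

(** This turns [VZN_domain] into the capacity bound required by [FZN_output]. *)
Lemma VZN_lt x m : [set j | (VZN x m j < m.+1)%N]%SET = services (line x m).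
Proof.
apply/setP => j; rewrite !finset.inE; case: m => [|m]; last exact: FZN_le_max.
by rewrite ltnS U1_le0.
Qed.

Lemma VZN_output x m : VZN_domain x -> (m < n)%N ->
  queue_output (@ord_pred N) (fun=> False) (VZN x m) (line x m.+1) (VZN x m.+1).
Proof. by move=> dom mn; apply: FZN_output; rewrite VZN_lt; exact: dom. Qed.

Lemma card_services_sort_at (s : 'I_N -> U 1) i :
  #|services (sort_at (@ord_pred N) s i)| = #|services s|.
Proof.
have [pii|pii] := eqVneq (ord_pred i) i; first by rewrite sort_at_id ?pii.
have cardE (t : 'I_N -> U 1) : #|services t| = (\sum_j (t j == particle))%N.
  rewrite -sum1_card big_mkcond /=.
  by apply: eq_bigr => j _; rewrite finset.inE; case: ifP.
rewrite !cardE (bigD1 i) //= [in RHS](bigD1 i) //=.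
rewrite (bigD1 (ord_pred i)) //= [in RHS](bigD1 (ord_pred i)) //=.
rewrite !addnA; congr (_ + _)%N; last first.
  apply: eq_bigr => j /andP[ji jpi].
  by rewrite /sort_at (negbTE ji) (negbTE jpi).
rewrite -!U1_le0 !sort_at_le eqxx (negbTE pii) eqxx.
by do 2 case: (_ <= 0)%N.
Qed.

Lemma card_services_mlbell x i m : (m <= n)%N ->
  #|services (line (mlbell (@ord_pred N) (@ordS N) x i) m)| = #|services (line x m)|.
Proof. by move=> mn; rewrite line_mlbell // card_services_sort_at. Qed.

Lemma VZN_domain_mlbell x i : VZN_domain x ->
  VZN_domain (mlbell (@ord_pred N) (@ordS N) x i).
Proof. by move=> dom m mn; rewrite !card_services_mlbell ?(ltnW mn) //; exact: dom. Qed.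

Lemma VZN_mlbell x i : VZN_domain x ->
  VZN (mlbell (@ord_pred N) (@ordS N) x i) n = sort_at (@ord_pred N) (VZN x n) i.
Proof.
move=> dom; rewrite /VZN.
rewrite (multiline_bell (@ord_predK N) (@ordSK N) (E := fun=> False)) ?subnn //; try by move=> ? [].
  by move=> m mn; exact: VZN_output.
move=> m mn d dout; apply: queue_output_uniqN dout _.
exact: VZN_output (VZN_domain_mlbell i dom) mn.
Qed.

End Multiline.
End Collapse.

(** * The queueing operator on Z *)

Section QueueZ.
Variable R : realType.
Implicit Types (i j l : int).

Lemma prvZK : cancel prvZ nxtZ. Proof. by move=> i; rewrite /prvZ /nxtZ; lia. Qed.
Lemma nxtZK : cancel nxtZ prvZ. Proof. by move=> i; rewrite /prvZ /nxtZ; lia. Qed.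

(** Windows are given by right end and length, so the empty window is allowed and induction on the
    length peels off [j]. *)
Definition count_back (p : pred int) j e : nat := (\sum_(k < e) p (j - k%:Z)%R)%N.

Lemma count_back0 p j : count_back p j 0 = 0%N.
Proof. by rewrite /count_back big_ord0. Qed.

Lemma count_backS p j e :
  count_back p j e.+1 = (p j + count_back p (prvZ j) e)%N.
Proof.
rewrite /count_back big_ord_recl subr0; congr (_ + _)%N.
by apply: eq_bigr => k _; rewrite lift0 /prvZ; congr (nat_of_bool (p _)); lia.
Qed.

Lemma eq_count_back (p q : pred int) j e :
  (forall i, j - e%:Z < i -> i <= j -> p i = q i) ->
  count_back p j e = count_back q j e.
Proof. by move=> pq; apply: eq_bigr => k _; rewrite pq //; have := ltn_ord k; lia. Qed.

Lemma leq_count_back (p q : pred int) j e :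
  (forall i, j - e%:Z < i -> i <= j -> p i -> q i) ->
  (count_back p j e <= count_back q j e)%N.
Proof.
move=> pq; apply: leq_sum => k _; case: (boolP (p _)) => // /pq -> //.
all: by have := ltn_ord k; lia.
Qed.

Lemma count_backD p j e e' :
  count_back p j (e + e') = (count_back p j e + count_back p (j - e%:Z) e')%N.
Proof.
elim: e j => [|e IH] j; first by rewrite count_back0 subr0.
rewrite addSn !count_backS IH addnA; congr (_ + count_back p _ e')%N.
by rewrite /prvZ; lia.
Qed.

Lemma uniform_window (P : int -> int -> Prop) :
  (forall j, exists L, forall l, l <= L -> P l j) ->
  forall j (e : nat), exists L, forall l, l <= L ->
    forall i, j - e%:Z <= i -> i <= j -> P l i.
Proof.
move=> exL j; elim=> [|e [L1 H1]].
  have [L HL] := exL j; exists L => l lL i ji ij.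
  by rewrite (_ : i = j); [exact: HL | lia].
have [L2 H2] := exL (j - e.+1%:Z).
exists (Num.min L1 L2) => l; rewrite le_min => /andP[l1 l2] i ji ij.
have [->|ne] := eqVneq i (j - e.+1%:Z); first exact: H2.
by apply: H1 => //; lia.
Qed.

Lemma count_itvE p i j : i <= j -> count_itv p i j = count_back p j `|j - i|.+1.
Proof.
move=> ij; rewrite /count_itv (reindex_inj rev_ord_inj).
by apply: eq_bigr => k _ /=; congr (nat_of_bool (p _)); have := ltn_ord k; lia.
Qed.

Section Queue.
Variables (m : nat) (a : int -> U m) (s : int -> U 1).

(** Positivity of the supremum is witnessed by a single window, so only finite counts occur from
    here on. *)
Lemma queue_gt0 k j : (0 < queue R a s k j)%E <-> exists e,
  (count_back (fun i => s i == particle) j e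
    < count_back (fun i => a i <= k)%N j e)%N.
Proof.
split=> [/ereal_sup_gt[_ [i ij <-]]|[[|e] lt_e]]; last 2 first.
- by move: lt_e; rewrite !count_back0.
- have ej : j - e%:Z <= j by lia.
  apply: lt_le_trans; last by apply: ereal_sup_ubound; exists (j - e%:Z).
  rewrite !count_itvE // (_ : absz (j - (j - e%:Z))%R = e) ?lte_fin; last by lia.
  by rewrite lt_max subr_gt0 ltr_nat lt_e orbT.
- rewrite lte_fin lt_max ltxx /= subr_gt0 ltr_nat !count_itvE // => lt_e.
  by eexists; exact: lt_e.
Qed.

Lemma FZ_le_max j : (FZ R a s j <= m)%N = (s j == particle).
Proof.
rewrite /FZ; case: ifP => _ /=; last by rewrite ltnn.
by rewrite inordK ?ltnS ?leqW ?find_iota_le_size.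
Qed.

(** The window now includes [j], whose own service turns the strict inequality of [queue_gt0] into a
    weak one. *)
Lemma FZ_le k j : (k < m)%N -> (FZ R a s j <= k)%N <->
  s j == particle /\ exists e,
    (count_back (fun i => s i == particle) j e.+1
      <= count_back (fun i => a i <= k)%N j e.+1)%N.
Proof.
move=> km; rewrite /FZ; case: ifP => [sj|_] /=; last by split=> [|[]//]; lia.
rewrite inordK ?ltnS ?leqW ?find_iota_le_size // find_iota_le //.
(* Both conditions are monotone in the class, so some class up to [k] qualifies exactly when [k]
   does. *)
transitivity ((0 < queue R a s k (prvZ j))%E \/ (a j <= k)%N).
  split=> [/hasP[r]|kP]; last first.
    by apply/hasP; exists k; [rewrite mem_iota add0n ltnS leqnn | exact: (introT orP kP)].
  rewrite mem_iota add0n ltnS => rk /(elimT orP)[/queue_gt0[e lt_e]|]; last first.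
    by move=> /leq_trans/(_ rk); right.
  left; apply/queue_gt0; exists e; apply: (leq_trans lt_e).
  by apply: leq_count_back => i _ _ /leq_trans; apply.
split=> [[/queue_gt0[e lt_e]|aj]|[_ [e]]].
- by split=> //; exists e; rewrite !count_backS sj; apply: leq_trans lt_e _; rewrite leq_addl.
- by split=> //; exists 0%N; rewrite !count_backS !count_back0 sj aj.
- rewrite !count_backS sj; case: (a j <= k)%N; first by right.
  by rewrite add0n add1n => lt_e; left; apply/queue_gt0; exists e.
Qed.

End Queue.

Lemma FZ_local m (a a' : int -> U m) s s' j :
  (forall i, i <= j -> a i = a' i) -> (forall i, i <= j -> s i = s' i) ->
  FZ R a s j = FZ R a' s' j.
Proof.
move=> aa' ss'; apply: class_inj => k; rewrite ltnS leq_eqVlt => /predU1P[->|km].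
  by rewrite !FZ_le_max ss'.
have cs e : count_back (fun i => s i == particle) j e
    = count_back (fun i => s' i == particle) j e.
  by apply: eq_count_back => i _ ij; rewrite ss'.
have ca e : count_back (fun i => a i <= k)%N j e = count_back (fun i => a' i <= k)%N j e.
  by apply: eq_count_back => i _ ij; rewrite aa'.
apply/idP/idP => /FZ_le-/(_ km)[sj [e le_e]]; apply/FZ_le => //.
  by rewrite -ss' //; split=> //; exists e; rewrite -cs -ca.
by rewrite ss' //; split=> //; exists e; rewrite cs ca.
Qed.

(** * Queues that are empty far to the left *)

Section HalfLine.
Variables (l : int) (m : nat) (a : int -> U m) (s : int -> U 1).

(** Unrolling the recursion bounds arrivals minus services on every window by the queue. Equality
    holds for the window that starts just after the last empty queue. *)
Lemma lindley_sup (p : pred int) (t : pred int) (q : int -> nat) :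
  lindley prvZ (fun j => p j) (fun j => t j) q ->
  (forall j, j <= l -> q j = 0%N) ->
  forall j, (0 < q j)%N <-> exists e, (count_back t j e < count_back p j e)%N.
Proof.
move=> ql q0; have le_q : forall e j, (count_back p j e <= count_back t j e + q j)%N.
  elim=> [|e IH] j; first by rewrite count_back0.
  by rewrite !count_backS; have := IH (prvZ j); have := ql j => /=; lia.
move=> j; split=> [qj|[e lt_e]]; last by have := le_q e j; lia.
suff ex_e : forall d : nat, exists e,
    (q (l + d%:Z)%R + count_back t (l + d%:Z)%R e)%N = count_back p (l + d%:Z) e.
  have [jl|lj] := leP j l; first by rewrite q0 in qj.
  have [e] := ex_e (absz (j - l)%R); rewrite (_ : l + _ = j); last lia.
  by exists e; lia.
elim=> [|d [e IH]]; first by exists 0%N; rewrite !count_back0 q0 ?addr0.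
have pd : prvZ (l + d.+1%:Z) = l + d%:Z by rewrite /prvZ; lia.
case qd : (q (l + d.+1%:Z)) => [|c]; first by exists 0%N; rewrite !count_back0.
by exists e.+1; rewrite !count_backS pd; have := ql (l + d.+1%:Z); rewrite pd /=; lia.
Qed.

Lemma FZ_le_lindley k (q : int -> nat) : (k < m)%N ->
  lindley prvZ (fun j => (a j <= k)%N) (fun j => s j == particle) q ->
  (forall j, j <= l -> q j = 0%N) ->
  forall j, (FZ R a s j <= k)%N
    = (s j == particle) && (0 < q (prvZ j) + (a j <= k)%N)%N.
Proof.
move=> km ql q0 j; have supP := lindley_sup ql q0.
apply/idP/andP => [/FZ_le-/(_ km)[sj [e le_e]]|[sj qa]].
  split=> //; move: le_e; rewrite !count_backS sj; case: (a j <= k)%N; first by rewrite addn1.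
  by rewrite addn0 add0n add1n => lt_e; apply/supP; exists e.
apply/FZ_le => //; split=> //; move: qa; case aj : (a j <= k)%N.
  by exists 0%N; rewrite !count_backS !count_back0 sj aj.
rewrite addn0 => /supP[e lt_e]; exists e; rewrite !count_backS sj.
by apply: leq_trans lt_e _; rewrite leq_addl.
Qed.

Lemma queue_output_uniqZ d :
  queue_output prvZ (fun j => j <= l) a s d -> d = FZ R a s.
Proof.
move=> [dm dq]; apply/funext => j; apply: class_inj => k.
rewrite ltnS leq_eqVlt => /predU1P[->|km]; first by rewrite dm FZ_le_max.
by have [q [ql q0 ->]] := dq k km; rewrite (FZ_le_lindley km ql q0).
Qed.

Lemma FZ_output : (forall j, j <= l -> a j = infty) ->
  queue_output prvZ (fun j => j <= l) a s (FZ R a s).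
Proof.
move=> a0; split=> [j|k km]; first exact: FZ_le_max.
(* [rec d] is the queue at [l + d], computed rightwards from an empty queue at [l]. *)
pose rec := fix rec (d : nat) : nat := if d is d'.+1 then
  (rec d' + (a (l + d%:Z)%R <= k)%N - (s (l + d%:Z)%R == particle))%N else 0%N.
pose q j : nat := if j <= l then 0%N else rec (absz (j - l)%R).
have q0 j : j <= l -> q j = 0%N by rewrite /q => ->.
have ql : lindley prvZ (fun j => (a j <= k)%N) (fun j => s j == particle) q.
  move=> j; rewrite {1}/q; case: ifPn => [jl|].
    by rewrite q0 ?a0 //= 1?leqNgt ?km ?sub0n // /prvZ; lia.
  rewrite -ltNge => lj; rewrite (_ : absz (j - l)%R = (absz (prvZ j - l)%R).+1); last first.
    by rewrite /prvZ; lia.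
  rewrite /= (_ : l + _ = j); last by rewrite /prvZ; lia.
  congr (_ + _ - _)%N; rewrite /q; case: ifPn => // pjl.
  by rewrite (_ : prvZ j = l) ?subrr // /prvZ; move: pjl; rewrite /prvZ; lia.
exists q; split=> // j; exact: FZ_le_lindley.
Qed.

End HalfLine.

Local Opaque FZ.

(** * Truncated states and their limit *)

Section Multiline.
Variables (n : nat).
Implicit Types (x y : mlstate int n) (m : nat).

Definition truncate l x : mlstate int n := fun c => if c.2 <= l then infty else x c.

Lemma VZ_le_max x m j : (VZ R x m j <= m)%N = (line x m j == particle).
Proof. by case: m => [|m]; [rewrite U1_le0 | exact: FZ_le_max]. Qed.

Lemma VZ_local x y j :
  (forall c, c.2 <= j -> x c = y c) ->
  forall m i, i <= j -> VZ R x m i = VZ R y m i.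
Proof.
move=> xy; elim=> [|m IH] i ij; first exact: xy.
apply: FZ_local => i' i'i; first by apply: IH; exact: le_trans ij.
by apply: xy; exact: le_trans ij.
Qed.

Lemma VZ_truncate0 l x m j : j <= l -> VZ R (truncate l x) m j = infty.
Proof.
move=> jl; have := VZ_le_max (truncate l x) m j.
rewrite /line /truncate /= jl => /negbT; rewrite -ltnNge => lt_m.
by apply/val_inj/eqP; rewrite eqn_leq lt_m andbT -ltnS /=.
Qed.

(* Removing the particles on a left half-line delays all customers. *)
Lemma VZ_truncate_ge l x m j : (VZ R x m j <= VZ R (truncate l x) m j)%N.
Proof.
elim: m j => [|m IH] j.
  by rewrite /= /line /truncate /=; case: ifP => // _; rewrite -ltnS.
apply: class_le => k; rewrite ltnS leq_eqVlt => /predU1P[->|km].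
  by rewrite !VZ_le_max /line /truncate /=; case: ifP.
move=> /FZ_le-/(_ km)[sj [e le_e]].
have [jl|lj] := leP j l; first by move: sj; rewrite /line /truncate /= jl.
apply/FZ_le => //; split; first by move: sj; rewrite /line /truncate /= leNgt lj.
set A' := count_back (fun i => VZ R (truncate l x) m i <= k)%N in le_e.
set S' := count_back _ in le_e.
have sE e' : j - e'%:Z >= l ->
    S' j e' = count_back (fun i => line x m.+1 i == particle) j e'.
  move=> le_l; apply: eq_count_back => i ij _.
  by rewrite /line /truncate /= ifN // -ltNge; lia.
have aE e' : (A' j e' <= count_back (fun i => VZ R x m i <= k)%N j e')%N.
  by apply: leq_count_back => i _ _; apply: leq_trans.
(* A window that crosses [l] is cut there: the removed piece has no arrivals in the truncated
   system, so the inequality survives. *)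
have [le_l|lt_l] := leP l (j - e.+1%:Z).
  by exists e; rewrite -sE //; apply: leq_trans le_e _.
have [c jc] : exists c : nat, j - c.+1%:Z = l by exists (absz (j - l)%R).-1; lia.
have ce : e.+1 = (c.+1 + (e - c))%N by lia.
exists c; rewrite -sE ?jc //; apply: leq_trans (aE _).
move: le_e; rewrite ce /S' /A' !count_backD jc => le_e.
have A0 : count_back (fun i => VZ R (truncate l x) m i <= k)%N l (e - c) = 0%N.
  apply: big1 => i _; rewrite VZ_truncate0 /=; last lia.
  by rewrite leqNgt km.
by move: le_e; rewrite A0; lia.
Qed.

(** A departure of class at most [k] is witnessed by one finite window, where the arrivals have
    stabilised by induction and truncation only removes services. The other inequality is
    [VZ_truncate_ge]. *)
Lemma VZ_truncate_lim x m j :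
  exists L, forall l, l <= L -> VZ R (truncate l x) m j = VZ R x m j.
Proof.
elim: m j => [|m IH] j.
  exists (j - 1) => l lj; rewrite /= /line /truncate /= ifN // -ltNge; lia.
have [ge_m|lt_m] := leqP m.+2 (VZ R x m.+1 j).
  exists 0 => l _; apply/val_inj/eqP; rewrite eqn_leq VZ_truncate_ge andbT.
  by apply: leq_trans ge_m; exact: (ltn_ord (VZ R (truncate l x) m.+1 j)).
suff [L le_L] : exists L, forall l, l <= L ->
    (VZ R (truncate l x) m.+1 j <= VZ R x m.+1 j)%N.
  by exists L => l lL; apply/val_inj/eqP; rewrite eqn_leq le_L // VZ_truncate_ge.
move: (leqnn (VZ R x m.+1 j)) lt_m; move: {2 3 4}(nat_of_ord _) => k le_k.
rewrite ltnS leq_eqVlt => /predU1P[kE|km].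
  exists (j - 1) => l lj; move: le_k; rewrite kE !VZ_le_max.
  by rewrite /line /truncate /= ifN // -ltNge; lia.
have [sj [e le_e]] := iffLR (FZ_le _ _ _ km) le_k.
have [L HL] := uniform_window IH j e.
exists (Num.min L (j - e.+1%:Z)) => l; rewrite le_min => /andP[lL lj].
apply/FZ_le => //; split; first by rewrite /line /truncate /= ifN // -ltNge; lia.
exists e; apply: leq_trans (leq_trans le_e _).
  apply: leq_count_back => i ij _; rewrite /line /truncate /=.
  by case: ifP.
apply: leq_count_back => i ij ij'.
by change (VZ R x m i <= k -> VZ R (truncate l x) m i <= k)%N; rewrite HL //; lia.
Qed.

Lemma bell_pos_bounds x i k :
  i <= bell_pos nxtZ x i k <= i + k%:Z.
Proof.
elim: k => [|k IH] /=; first by rewrite addr0 lexx.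
by case: ifP => _; move: IH; move: (bell_pos nxtZ x i k : int) => b; rewrite /nxtZ; lia.
Qed.

Lemma bell_pos_truncate l x i k : l < i ->
  bell_pos nxtZ (truncate l x) i k = bell_pos nxtZ x i k.
Proof.
move=> li; elim: k => //= k IH; rewrite IH.
have := bell_pos_bounds x i k => /andP[ib _].
rewrite (_ : line (truncate l x) _ _ = line x (n - k) (bell_pos nxtZ x i k)) //.
by rewrite /line /truncate /= ifN // -ltNge; exact: lt_le_trans ib.
Qed.

(** On each line the bell lands at some [b >= i], so the truncation keeps both [b] and [b - 1]. *)
Lemma truncate_mlbell l x i : l + 1 < i ->
  truncate l (mlbell prvZ nxtZ x i) = mlbell prvZ nxtZ (truncate l x) i.
Proof.
move=> li; apply/funext => -[m j]; rewrite /truncate /mlbell /= -/(truncate l x).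
rewrite bell_pos_truncate; last lia.
have := bell_pos_bounds x i (n - m); move: (bell_pos nxtZ x i (n - m) : int) => b /andP[ib _].
rewrite /sort_at /line /truncate /=.
have lb : (b <= l) = false by apply/negbTE; rewrite -ltNge; lia.
have lpb : (prvZ b <= l) = false by apply/negbTE; rewrite -ltNge /prvZ; lia.
rewrite lb lpb; case: ifPn => // jl.
case: eqP => [jb|_]; first by rewrite -jb jl in lb.
by case: eqP => [jb|_ //]; rewrite -jb jl in lpb.
Qed.

(** Here each [b] is at most [i + n <= l], so only removed sites are exchanged. *)
Lemma truncate_mlbell_left l x i : i + n%:Z <= l ->
  truncate l (mlbell prvZ nxtZ x i) = truncate l x.
Proof.
move=> il; apply/funext => -[m j]; rewrite /truncate /mlbell /=.
case: ifPn => //; rewrite -ltNge => lj.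
have := bell_pos_bounds x i (n - m); move: (bell_pos nxtZ x i (n - m) : int) => b /andP[_ bi].
rewrite /sort_at !ifN /line ?inord_val // /prvZ; apply/eqP; lia.
Qed.

Lemma VZ_truncate_mlbell l x i : l + 1 < i ->
  VZ R (mlbell prvZ nxtZ (truncate l x) i) n
  = sort_at prvZ (VZ R (truncate l x) n) i.
Proof.
move=> li; rewrite /VZ.
rewrite (multiline_bell prvZK nxtZK (E := fun j => j <= l)) ?subnn //.
- move=> k; rewrite bell_pos_truncate; last lia.
  by have := bell_pos_bounds x i k; move: (bell_pos nxtZ x i k : int) => b; lia.
- move=> k; rewrite bell_pos_truncate; last lia.
  by have := bell_pos_bounds x i k; move: (bell_pos nxtZ x i k : int) => b; rewrite /prvZ; lia.
- by move=> m mn; apply: FZ_output => j jl; exact: VZ_truncate0.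
by move=> m mn d; exact: queue_output_uniqZ.
Qed.

Lemma VZ_mlbell x i :
  VZ R (mlbell prvZ nxtZ x i) n = sort_at prvZ (VZ R x n) i.
Proof.
apply/funext => j.
have [L1 H1] := VZ_truncate_lim (mlbell prvZ nxtZ x i) n j.
have [L2 H2] := VZ_truncate_lim x n j.
have [L3 H3] := VZ_truncate_lim x n i.
have [L4 H4] := VZ_truncate_lim x n (prvZ i).
(* [l] lies below the stabilisation thresholds at all sites involved; [i - 2] lets the truncation
   commute with the bell. *)
set l := Num.min (Num.min L1 L2) (Num.min (Num.min L3 L4) (i - 2)).
have [lL1 lL2 lL3 lL4 li] : [/\ l <= L1, l <= L2, l <= L3, l <= L4 & l <= i - 2].
  by rewrite /l !ge_min !lexx !orbT.
rewrite -(H1 _ lL1) truncate_mlbell ?VZ_truncate_mlbell; try lia.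
move: (H2 _ lL2) (H3 _ lL3) (H4 _ lL4).
move: (VZ R (truncate l x) n) (VZ R x n) => u v uj ui upi.
by rewrite /sort_at uj ui upi.
Qed.

End Multiline.
End QueueZ.

(** * Paths driven by bells *)

Section Paths.
Variable R : realType.
Local Open Scope classical_set_scope.

(** The infimum of the failing times yields a contradiction. This replaces induction over jump
    times, as on the line there need be no first bell. *)
Lemma real_induction (P : R -> Prop) : P 0 ->
  (forall t, 0 <= t -> P t -> \forall s \near t^'+, P s) ->
  (forall t, 0 < t -> (forall s, 0 <= s -> s < t -> P s) -> P t) ->
  forall t, 0 <= t -> P t.
Proof.
move=> P0 Pright Pleft t t0; apply: contrapT => nPt.
pose S := [set s : R | 0 <= s /\ ~ P s].
have lbS : lbound S 0 by move=> s [].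
have infS : has_inf S by split; [exists t | exists 0].
have inf0 : 0 <= inf S by apply: lb_le_inf => //; exists t.
have below s : 0 <= s -> s < inf S -> P s.
  move=> s0 s_lt; apply: contrapT => nPs.
  by move: s_lt; rewrite ltNge => /negP; apply; apply: ge_inf; [exists 0 | split].
have Pinf : P (inf S).
  by move: inf0; rewrite le_eqVlt => /predU1P[<-//|/Pleft]; apply.
have /nbhs_ballP[e /= e0 He] := Pright _ inf0 Pinf.
have [s [s0 nPs] s_lt] := inf_adherent e0 infS.
have inf_le_s : inf S <= s by apply: ge_inf; [exists 0 | split].
apply: nPs; move: inf_le_s; rewrite le_eqVlt => /predU1P[E|lt_s]; first by rewrite E in Pinf.
by apply: He => //; rewrite -ball_normE /= ltr0_norm ?opprB; lra.
Qed.

Lemma rings_pos (N : R -> nat) t s : (forall u v, 0 <= u -> u <= v -> (N u <= N v)%N) ->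
  N 0 = 0%N -> 0 < t -> t < s -> rings N t -> (0 < N s)%N.
Proof.
by move=> Nmono N0 t0 ts /(_ 0 (lexx _) t0); rewrite N0 => /leq_trans; apply; apply: Nmono; lra.
Qed.

Lemma driven_by_cases I C E (upd : (C -> E) -> I -> C -> E) N (X : R -> C -> E) t u :
  (forall i, rings (N i) t -> X t = upd u i) -> ((forall i, ~ rings (N i) t) -> X t = u) ->
  (exists2 i, rings (N i) t & X t = upd u i) \/ (forall i, ~ rings (N i) t) /\ X t = u.
Proof.
move=> Xring Xno; have [[i it]|no] := pselect (exists i, rings (N i) t).
  by left; exists i => //; exact: Xring.
have {}no : forall i, ~ rings (N i) t by move=> i it; apply: no; exists i.
by right; split=> //; exact: Xno.
Qed.

Section Cycle.
Variables (N n : nat) (bells : 'I_N -> R -> nat) (X : R -> mlstate 'I_N n).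
Hypothesis Xdriven : driven_by (@mlbell 'I_N (@ord_pred N) (@ordS N) n) bells X.

(** Coordinates are finitely many on the cycle, so coordinatewise limits are eventual equalities; a
    left limit is then the state at times just before. *)
Lemma near_state (F : set_system R) (u : mlstate 'I_N n) {FF : Filter F} :
  (forall c, \forall s \near F, X s c = u c) -> \forall s \near F, X s = u.
Proof. by move=> /filter_forall; apply: filterS => s Xs; apply/funext. Qed.

Lemma driven_domain : VZN_domain (X 0) -> forall t, 0 <= t -> VZN_domain (X t).
Proof.
move=> dom0; have [Xright Xleft] := Xdriven; apply: real_induction => // t t0.
  move=> dom; near=> s.
  suff -> : X s = X t by [].
  by near: s; apply: near_state => c; exact: Xright.
move=> dom; have [u [Xu Xring Xno]] := Xleft t t0.
have domu : VZN_domain u.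
  near t^'- => s.
  have <- : X s = u by near: s; exact: near_state.
  by apply: dom; near: s; [exact: nbhs_left_ge | exact: nbhs_left_lt].
have [[i _ ->]|[_ ->]] := driven_by_cases Xring Xno => //.
exact: VZN_domain_mlbell.
Unshelve. all: by end_near. Qed.

Lemma driven_VZN : VZN_domain (X 0) ->
  driven_by (@sort_at 'I_N (@ord_pred N) n.+1) bells (fun t => VZN (X t) n).
Proof.
move=> dom0; have dom := driven_domain dom0; have [Xright Xleft] := Xdriven.
split=> [t c t0|t t0].
  near=> s; suff -> : X s = X t by [].
  by near: s; apply: near_state => c'; exact: Xright.
have [u [Xu Xring Xno]] := Xleft t t0.
have nearu := near_state Xu.
have domu : VZN_domain u.
  near t^'- => s.
  have <- : X s = u by near: s; exact: nearu.
  by apply: dom; near: s; exact: nbhs_left_ge.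
exists (VZN u n); split=> [c|i it|no].
- by near=> s; suff -> : X s = u by []; near: s; exact: nearu.
- by rewrite (Xring i it) VZN_mlbell.
- by rewrite (Xno no).
Unshelve. all: by end_near. Qed.

End Cycle.

Section Line.
Variables (n : nat) (bells : int -> R -> nat) (X : R -> mlstate int n).
Hypothesis Xdriven : driven_by (@mlbell int prvZ nxtZ n) bells X.
Implicit Types (i j l r b : int) (t s T : R).

Definition silent T i := forall t, 0 < t -> t < T -> ~ rings (bells i) t.

(* Bells at other sites act on either side of the edge (l, l+1), on every line. *)
Definition silent_window T l :=
  forall i, l - n%:Z <= i -> i <= l + 1 -> silent T i.

Local Opaque FZ VZ.
Let Vl l t := VZ R (truncate l (X t)) n.

(** Up to site [r] a truncated image depends only on the finitely many coordinates with sites in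
    [(l, r]], so coordinatewise limits pass through it. *)
Lemma near_VZ_truncate (F : set_system R) (u : mlstate int n) l r {FF : Filter F} :
  (forall c, \forall s \near F, X s c = u c) ->
  \forall s \near F, forall j, j <= r ->
    VZ R (truncate l (X s)) n j = VZ R (truncate l u) n j.
Proof.
move=> Xu.
have /filter_forall : forall c : 'I_n.+1 * 'I_(absz (r - l)%R),
    \forall s \near F, X s (c.1, r - (c.2 : nat)%:Z) = u (c.1, r - (c.2 : nat)%:Z).
  by move=> c; exact: Xu.
apply: filterS => s Xs j jr; apply: VZ_local (jr) => -[m i] /= ir.
rewrite /truncate /=; case: ifPn => // li.
have ri : (absz (r - i)%R < absz (r - l)%R)%N by lia.
have := Xs (m, Ordinal ri).
by rewrite /= (_ : r - _ = i) //; lia.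
Qed.

Lemma near_VZ_truncate_at (F : set_system R) (u : mlstate int n) l c {FF : Filter F} :
  (forall c, \forall s \near F, X s c = u c) ->
  \forall s \near F, VZ R (truncate l (X s)) n c = VZ R (truncate l u) n c.
Proof. by move=> /(near_VZ_truncate l c); apply: filterS => s; apply. Qed.

(** Bells right of the window are handled by [VZ_truncate_mlbell], silence excludes those inside,
    and those on the left touch removed sites only, where the image is constantly [infty]. *)
Lemma VZ_truncate_driven t u l T : silent_window T l -> 0 < t -> t < T ->
  (forall i, rings (bells i) t -> X t = mlbell prvZ nxtZ u i) ->
  forall i, rings (bells i) t -> Vl l t = sort_at prvZ (VZ R (truncate l u) n) i.
Proof.
move=> sil t0 tT Xring i it; rewrite /Vl (Xring _ it).
have [li|il] := ltP (l + 1) i.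
  by rewrite truncate_mlbell // VZ_truncate_mlbell.
have [li|{}il] := leP (l - n%:Z) i; first by case: (sil i li il t t0 tT).
rewrite truncate_mlbell_left ?sort_at_id //; last lia.
by rewrite !VZ_truncate0 // /prvZ; lia.
Qed.

(** Silence at [b + 1] and [r + 1] blocks the edges [(b, b + 1)] and [(r, r + 1)], so the sites
    between form a closed system in which both images undergo the same sortings. *)
Lemma agree_between l l' b r T : silent_window T l -> silent_window T l' ->
  silent T (b + 1) -> silent T (r + 1) ->
  (forall j, b < j -> j <= r -> Vl l 0 j = Vl l' 0 j) ->
  forall t, 0 <= t -> t < T -> forall j, b < j -> j <= r -> Vl l t j = Vl l' t j.
Proof.
move=> sl sl' sb sr agree0; have [Xright Xleft] := Xdriven.
apply: real_induction => [//|t t0 agree|t t0 agree tT].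
  have [tT|Tt] := ltP t T; last first.
    near=> s; move=> sT; suff : t < s by lra.
    by near: s; exact: nbhs_right_gt.
  near=> s => _ j bj jr.
  have <- : Vl l t j = Vl l s j.
    rewrite /Vl; symmetry; move: j jr {bj}; near: s.
    by apply: near_VZ_truncate => c; exact: (Xright t c t0).
  have <- : Vl l' t j = Vl l' s j.
    rewrite /Vl; symmetry; move: j jr {bj}; near: s.
    by apply: near_VZ_truncate => c; exact: (Xright t c t0).
  exact: agree.
have [u [Xu Xring Xno]] := Xleft t t0.
have agreeu j : b < j -> j <= r ->
    VZ R (truncate l u) n j = VZ R (truncate l' u) n j.
  near t^'- => s => bj jr.
  have s0 : 0 <= s by near: s; exact: nbhs_left_ge.
  have st : s < t by near: s; exact: nbhs_left_lt.
  have <- : VZ R (truncate l (X s)) n j = VZ R (truncate l u) n j.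
    by move: j jr {bj}; near: s; exact: near_VZ_truncate.
  have <- : VZ R (truncate l' (X s)) n j = VZ R (truncate l' u) n j.
    by move: j jr {bj}; near: s; exact: near_VZ_truncate.
  by apply: (agree s) => //; exact: lt_trans tT.
have [[i it _]|[_ Xt]] := driven_by_cases Xring Xno; last by rewrite /Vl Xt.
have ib : i != b + 1 by apply/eqP => ib; rewrite ib in it; exact: (sb t).
have ir : i != r + 1 by apply/eqP => ir; rewrite ir in it; exact: (sr t).
move=> j bj jr.
rewrite (VZ_truncate_driven sl t0 tT Xring it) (VZ_truncate_driven sl' t0 tT Xring it).
move: (VZ R (truncate l u) n) (VZ R (truncate l' u) n) agreeu => v v' agreeu.
rewrite /sort_at; case: eqP => [ji|_].
  by rewrite !agreeu // /prvZ; lia.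
case: eqP => [ji|_]; last exact: agreeu.
by rewrite !agreeu //; move: ji bj jr; rewrite /prvZ; lia.
Unshelve. all: by end_near. Qed.

Lemma driven_VZ :
  (forall (T : nat) L, exists2 l, l <= L & silent_window T%:R l) ->
  (forall (T : nat) c, exists2 r, c <= r & silent T%:R (r + 1)) ->
  driven_by (@sort_at int prvZ n.+1) bells (fun t => VZ R (X t) n).
Proof.
move=> left_silent right_silent; have [Xright Xleft] := Xdriven.
(* Once l is far enough to the left, truncation at l is invisible at c during
   the whole time interval, by comparing the truncations at two windows. *)
have uniform (T : nat) c : exists2 l, silent_window T%:R l &
    forall l', l' <= l -> silent_window T%:R l' ->
    forall t, 0 <= t -> t < T%:R -> Vl l' t c = Vl l t c.
  (* A silent site is found on each side of [c], then a threshold at time 0 valid on the whole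
     stretch between. *)
  have [b bc bsil] := left_silent T (c - 1).
  have [r cr rsil] := right_silent T c.
  have [L HL] := uniform_window (VZ_truncate_lim R (X 0) n) r (absz (r - b)%R).
  have [l lL lsil] := left_silent T L; exists l => // l' ll' l'sil t t0 tT.
  apply: (@agree_between l' l b r T%:R) => //; last lia.
    by apply: bsil; lia.
  by move=> j bj jr; rewrite /Vl (HL l') ?(HL l) //; lia.
have limit (T : nat) c : exists2 l, silent_window T%:R l &
    (forall t, 0 <= t -> t < T%:R -> VZ R (X t) n c = Vl l t c) /\
    (forall t u, 0 < t -> t < T%:R -> (forall c, \forall s \near t^'-, X s c = u c) ->
      VZ R u n c = VZ R (truncate l u) n c).
  have [l lsil Hl] := uniform T c; exists l => //; split=> [t t0 tT|t u t0 tT Xu].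
    (* [L] depends on [t] but [l] does not: a window [l'] below both links the full image at time
       [t] to [Vl l]. *)
    have [L HL] := VZ_truncate_lim R (X t) n c.
    have [l' l'L l'sil] := left_silent T (Num.min L l).
    rewrite le_min in l'L; have /andP[l'l l'L'] := l'L.
    by rewrite -(HL l' l'l); exact: Hl.
  (* For a left limit the two truncations are compared at times just before [t]. *)
  have [L HL] := VZ_truncate_lim R u n c.
  have [l' l'L l'sil] := left_silent T (Num.min L l).
  rewrite le_min in l'L; have /andP[l'l l'L'] := l'L.
  rewrite -(HL l' l'l).
  near t^'- => s.
  have <- : Vl l' s c = VZ R (truncate l' u) n c.
    by near: s; exact: near_VZ_truncate_at.
  have <- : Vl l s c = VZ R (truncate l u) n c.
    by near: s; exact: near_VZ_truncate_at.
  apply: Hl => //; first by near: s; exact: nbhs_left_ge.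
  by apply: lt_trans tT; near: s; exact: nbhs_left_lt.
split=> [t c t0|t t0].
  have [l _ [Hl _]] := limit (Num.bound t) c.
  have tT := archi_boundP t0.
  near=> s.
  have ts : t < s by near: s; exact: nbhs_right_gt.
  have sT : s < (Num.bound t)%:R by near: s; exact: nbhs_right_lt.
  rewrite (Hl t t0 tT) (Hl s (le_trans t0 (ltW ts)) sT).
  by near: s; apply: near_VZ_truncate_at => c'; exact: Xright.
have [u [Xu Xring Xno]] := Xleft t t0; exists (VZ R u n); split=> [c|i it|no].
- have [l _ [Hl Hu]] := limit (Num.bound t) c.
  have tT := archi_boundP (ltW t0).
  rewrite (Hu t u t0 tT Xu); near=> s.
  have s0 : 0 <= s by near: s; exact: nbhs_left_ge.
  have st : s < t by near: s; exact: nbhs_left_lt.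
  rewrite (Hl s s0 (lt_trans st tT)).
  by near: s; exact: near_VZ_truncate_at.
- by rewrite (Xring i it) VZ_mlbell.
- by rewrite (Xno no).
Unshelve. all: by end_near. Qed.

End Line.
End Paths.

(** * Measurability and silent windows *)

Section Measurability.
Local Open Scope classical_set_scope.
Context d (T : measurableType d).

Lemma measurable_finite_data (J E : finType) (f : J -> T -> E)
    (B : set {ffun J -> E}) :
  (forall j e, measurable [set w | f j w = e]) ->
  measurable [set w | B [ffun j => f j w]].
Proof.
move=> mf.
rewrite (_ : [set _ | _] = \bigcup_(g in B) \bigcap_(j in [set: J]) [set w | f j w = g j]).
  apply: fin_bigcup_measurable => [|g _]; first exact: finite_finset.
  by apply: fin_bigcap_measurable => [|j _]; [exact: finite_finset | exact: mf].
apply/seteqP; split=> [w Bw|w [g Bg fg]] /=.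
  by exists [ffun j => f j w] => // j _ /=; rewrite ffunE.
rewrite (_ : [ffun j => _] = g) //.
by apply/ffunP => j; rewrite ffunE; exact: fg.
Qed.

Lemma measurable_VZN N n (X : T -> mlstate 'I_N n) :
  (forall c e, measurable [set w | X w c = e]) ->
  forall c e, measurable [set w | VZN (X w) n c = e].
Proof.
move=> mX c e.
have := @measurable_finite_data _ _ (fun j w => X w j)
  [set g : {ffun 'I_n.+1 * 'I_N -> U 1} | VZN g n c = e] mX.
congr (measurable _); apply/seteqP; split=> w /=.
all: by rewrite (_ : ([ffun j => X w j] : mlstate 'I_N n) = X w) //;
  apply/funext => j; rewrite ffunE.
Qed.

Lemma measurable_class n (v : T -> U n) :
  (forall k, (k < n)%N -> measurable [set w | (v w <= k)%N]) ->
  forall e, measurable [set w | v w = e].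
Proof.
move=> mv e.
have {}mv k : measurable [set w | (v w <= k)%N].
  have [/mv//|nk] := ltnP k n.
  rewrite (_ : [set _ | _] = setT) //; apply/seteqP; split=> // w _ /=.
  by apply: leq_trans nk; rewrite -ltnS.
rewrite (_ : [set _ | _] = [set w | (v w <= e)%N] `\` [set w | (v w < e)%N]).
  apply: measurableD => //; case: (nat_of_ord e) => [|k]; last exact: mv.
  by rewrite (_ : [set _ | _] = set0) //; apply/seteqP; split.
apply/seteqP; split=> w /=; first by move=> ->; rewrite ltnn.
by case=> le_e /negP; rewrite -leqNgt => ge_e; apply/val_inj/eqP; rewrite eqn_leq le_e.
Qed.

(** By [FZ_le] the events are countable unions, over window lengths, of events on finitely many
    coordinates. *)
Lemma measurable_VZ (R : realType) n (X : T -> mlstate int n) :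
  (forall c e, measurable [set w | X w c = e]) ->
  forall m c e, measurable [set w | VZ R (X w) m c = e].
Proof.
move=> mX; elim=> [|m IH] c; first by move=> e; exact: mX.
apply: measurable_class => k; rewrite ltnS leq_eqVlt => /predU1P[->|km].
  rewrite (_ : [set _ | _] = [set w | X w (inord m.+1, c) = particle]) //.
  by apply/seteqP; split=> w /=; rewrite VZ_le_max => /eqP.
rewrite (_ : [set _ | _] = [set w | X w (inord m.+1, c) = particle] `&`
  \bigcup_e [set w | (count_back (fun i => line (X w) m.+1 i == particle) c e.+1
    <= count_back (fun i => (VZ R (X w) m i <= k)%N) c e.+1)%N]).
  apply: measurableI => //; apply: bigcupT_measurable => e.
  pose f (j : 'I_e.+1) w := (line (X w) m.+1 (c - (j : nat)%:Z), VZ R (X w) m (c - (j : nat)%:Z)).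
  have := @measurable_finite_data _ (U 1 * U m.+1)%type f
    [set g : {ffun 'I_e.+1 -> U 1 * U m.+1} | (\sum_(j < e.+1) ((g j).1 == particle)
      <= \sum_(j < e.+1) ((g j).2 <= k))%N].
  have mf j p : measurable [set w | f j w = p].
    rewrite (_ : [set _ | _] = [set w | X w (inord m.+1, c - (j : nat)%:Z) = p.1] `&`
      [set w | VZ R (X w) m (c - (j : nat)%:Z) = p.2]).
      by apply: measurableI => //; exact: IH.
    apply/seteqP; split=> w /=; rewrite /f /line; first by move=> <-.
    by move=> [-> ->]; case: (p).
  move=> /(_ mf); congr (measurable _); apply/funext => w /=.
  by congr (is_true (_ <= _)%N); apply: eq_bigr => j _; rewrite ffunE.
apply/seteqP; split=> w /=.
  by move/FZ_le => /(_ km)[/eqP sc [e le_e]]; split=> //; exists e.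
by move=> [sc [e _ le_e]]; apply/FZ_le => //; split; [exact/eqP | exists e].
Qed.

End Measurability.

(** * Almost sure existence of silent blocks *)

Section Silence.
Variable R : realType.
Local Open Scope classical_set_scope.
Context d (T : measurableType d) (P : probability T R).

Lemma prob_eq_ae (A B : set T) : measurable A -> measurable B ->
  {ae P, forall w, A w <-> B w} -> P A = P B.
Proof.
suff le_ae (A' B' : set T) : measurable A' -> measurable B' ->
    {ae P, forall w, A' w <-> B' w} -> (P A' <= P B')%E.
  move=> mA mB AB; apply/eqP; rewrite eq_le !le_ae //.
  by apply: filterS AB => w []; split.
move=> mA mB [D [mD PD AB]].
have : (P A' <= P (B' `|` D))%E.
  apply: le_measure; rewrite ?inE //; first exact: measurableU.
  move=> w Aw; have [Dw|nDw] := pselect (D w); [by right | left].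
  have : A' w <-> B' w by apply: contrapT => nAB; apply: nDw; exact: AB.
  by move=> [+ _]; apply.
move=> /le_trans; apply; apply: le_trans (measureU2 _ mB mD) _.
by rewrite [X in (_ + X)%E]PD adde0.
Qed.

Section Blocks.
Variables (I : choiceType) (A : I -> set T) (p : R) (w : nat -> seq I) (M : nat).
Hypothesis mA : forall i, measurable (A i).
Hypothesis PA : forall s, uniq s -> P (\bigcap_(i in [set` s]) A i) = (p ^+ size s)%:E.
Hypothesis size_w : forall k, size (w k) = M.
Let Z (s : seq I) := \bigcap_(i in [set` s]) A i.
Let C K := \bigcap_(k < K) ~` Z (w k).

Let mZ s : measurable (Z s).
Proof. by apply: fin_bigcap_measurable => //; exact: finite_seq. Qed.

Let mC K : measurable (C K).
Proof. by apply: bigcap_measurableType => k _; exact: measurableC. Qed.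

Let Z_cat s s' : Z (s ++ s') = Z s `&` Z s'.
Proof.
apply/seteqP; split=> [x Zx|x [Zs Zs'] i /=].
  by split=> i /= si; apply: Zx; rewrite /= mem_cat si ?orbT.
by rewrite mem_cat => /orP[/Zs|/Zs'].
Qed.

Let CS K : C K.+1 = C K `\` Z (w K).
Proof.
apply/seteqP; split=> [x Cx|x [Cx Zx] k /=].
  by split; [move=> k kK; exact: (Cx k (ltn_trans kK (ltnSn K))) | exact: (Cx K (ltnSn K))].
by rewrite ltnS leq_eqVlt => /predU1P[->//|/Cx].
Qed.

(** The extra list [s] closes the induction: excluding block [w K] subtracts the same expression
    with [s ++ w K] for [s]. *)
Lemma prob_no_block K s : uniq (s ++ flatten [seq w k | k <- iota 0 K]) ->
  P (Z s `&` C K) = (p ^+ size s * (1 - p ^+ M) ^+ K)%:E.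
Proof.
elim: K s => [|K IH] s us.
  rewrite (_ : C 0 = setT) ?setIT; last by rewrite /C; apply/seteqP; split=> // x _ k.
  by rewrite PA ?expr0 ?mulr1 //; move: us; rewrite cats0.
have us' : uniq ((s ++ w K) ++ flatten [seq w k | k <- iota 0 K]).
  move: us; rewrite -[X in iota 0 X]addn1 iotaD map_cat flatten_cat /= cats0 add0n.
  set F := flatten _; have /perm_uniq -> : perm_eq (s ++ F ++ w K) ((s ++ w K) ++ F) => //.
  by rewrite -catA perm_cat2l perm_catC.
have mZC : measurable (Z s `&` C K) by apply: measurableI; [exact: mZ | exact: mC].
rewrite CS setIDA measureD //; last first.
  by rewrite (le_lt_trans (probability_le1 _ mZC)) ?ltry.
have us0 : uniq (s ++ flatten [seq w k | k <- iota 0 K]).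
  apply: subseq_uniq us; rewrite -[K.+1]addn1 iotaD map_cat flatten_cat.
  by rewrite catA prefix_subseq.
rewrite setIAC -Z_cat.
transitivity ((p ^+ size s * (1 - p ^+ M) ^+ K)%:E
  - (p ^+ size (s ++ w K) * (1 - p ^+ M) ^+ K)%:E)%E.
  by congr (_ - _)%E; exact: IH.
rewrite size_cat size_w -EFinD exprS exprD; congr (_%:E); ring.
Qed.

(** The first [K] blocks all fail with probability [(1 - p ^+ M) ^+ K], which tends to 0. *)
Lemma ae_block : 0 < p <= 1 ->
  (forall K, uniq (flatten [seq w k | k <- iota 0 K])) ->
  {ae P, forall x, exists k, Z (w k) x}.
Proof.
move=> /andP[p0 p1] uw.
exists (\bigcap_K C K); split.
- exact: bigcapT_measurable.
- have PC K : (P (\bigcap_K C K) <= ((1 - p ^+ M) ^+ K)%:E)%E.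
    have := prob_no_block (uw K : uniq ([::] ++ _)).
    rewrite expr0 mul1r => <-; apply: le_measure; rewrite ?inE.
    + exact: bigcapT_measurable.
    + exact: measurableI.
    + by move=> x Cx; split; [move=> i | exact: Cx].
  apply/eqP; rewrite eq_le measure_ge0 andbT; apply/lee_addgt0Pr => e e0.
  rewrite add0e.
  have q1 : `|1 - p ^+ M| < 1.
    have pM0 : 0 < p ^+ M by exact: exprn_gt0.
    have pM1 : p ^+ M <= 1 by apply: exprn_ile1 => //; exact: ltW.
    by rewrite ger0_norm; lra.
  have /cvgrPdist_lt/(_ _ e0)[K _ /(_ K (leqnn K))] := cvg_expr q1.
  rewrite /= sub0r normrN => lt_e; apply: (le_trans (PC K)); rewrite lee_fin.
  by apply: le_trans (ler_norm _) (ltW lt_e).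
- move=> x /= noZ K _ k _ Zk; apply: noZ; by exists k.
Qed.

End Blocks.

Section Poisson.
Variables (I : choiceType) (N : I -> R -> T -> nat) (G : set (set T)).
Hypothesis NP : forall i, poisson_process P (N i).
Hypothesis indep : mutually_independent P
  (fun o : option I => if o is Some i then sigma_process (N i) else G).

Let mN i t k : 0 <= t -> measurable [set w | N i t w = k].
Proof.
move=> t0; have [mN _ _ _] := NP i.
by have := mN t t0 measurableT [set k] Logic.I; rewrite setTI.
Qed.

Lemma poisson_no_ring i t : 0 < t -> P [set w | N i t w = 0%N] = (expR (- t))%:E.
Proof.
move=> t0; have [mNi aeN pmf _] := NP i.
have := pmf 0 t 0%N (lexx _) t0; rewrite subr0 /poisson_pmf t0 fact0 expr0 divr1 mul1r => <-.
apply: prob_eq_ae; first exact: mN (ltW t0).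
  (* Subtraction is truncated, so a zero increment only says [N i t w <= N i 0 w], which is split
     over the value at time 0. *)
  rewrite (_ : [set _ | _] = \bigcup_k ([set w | N i 0 w = k]
      `&` \bigcup_(j in [set j | (j <= k)%N]) [set w | N i t w = j])).
    apply: bigcupT_measurable => k; apply: measurableI; first exact: mN.
    by apply: bigcup_measurable => j _; exact: mN (ltW t0).
  apply/seteqP; split=> w /=.
    by move=> /eqP; rewrite subn_eq0 => le_N; exists (N i 0 w) => //; split=> //; exists (N i t w).
  by move=> [k _ [<- [j /= jk ->]]]; apply/eqP; rewrite subn_eq0.
by apply: filterS aeN => w [N0 _ _] /=; rewrite N0 subn0.
Qed.

Lemma poisson_no_rings s t : 0 < t -> uniq s ->
  P (\bigcap_(i in [set` s]) [set w | N i t w = 0%N]) = (expR (- t) ^+ size s)%:E.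
Proof.
move=> t0 us.
have := indep (s := map Some s)
  (A := fun o => if o is Some i then [set w | N i t w = 0%N] else setT).
rewrite map_inj_uniq; last by move=> ? ? [].
move=> /(_ us); rewrite big_map.
have -> : (\prod_(i <- s) P [set w | N i t w = 0%N] = (expR (- t) ^+ size s)%:E)%E.
  elim: (s) => [|i s' IH]; first by rewrite big_nil.
  by rewrite big_cons IH poisson_no_ring // exprS EFinM.
rewrite (_ : \bigcap_(o in _) _ = \bigcap_(i in [set` s]) [set w | N i t w = 0%N]).
  apply=> o /mapP[i _ ->]; apply: sub_sigma_algebra.
  by exists t, 0%N; split=> //; exact: ltW.
apply/seteqP; split=> w Hw.
  by move=> i si; apply: (Hw (Some i)) => /=; apply/mapP; exists i.
by move=> o /= /mapP[i si ->]; exact: Hw.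
Qed.

Lemma ae_silent_block (h : nat -> I) M t : injective h -> 0 < t ->
  {ae P, forall w, exists k, forall e, (e < M)%N -> N (h (k * M + e)%N) t w = 0%N}.
Proof.
move=> hinj t0.
have := @ae_block I (fun i => [set w | N i t w = 0%N]) (expR (- t))
  (fun k => [seq h (k * M + e)%N | e <- iota 0 M]) M.
have flattenE K : flatten [seq [seq h (k * M + e)%N | e <- iota 0 M] | k <- iota 0 K]
    = map h (iota 0 (K * M)).
  elim: K => [|K IH] //.
  rewrite -[K.+1]addn1 iotaD map_cat flatten_cat IH /= cats0 add0n.
  rewrite mulnDl mul1n iotaD map_cat add0n; congr (_ ++ _).
  by rewrite -[in RHS](addn0 (K * M)%N) iotaDl -map_comp.
move=> /(_ (fun i => mN i 0 (ltW t0)) (fun s => @poisson_no_rings s t t0)) block.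
have : {ae P, forall w, exists k, (\bigcap_(i in [set` [seq h (k * M + e)%N | e <- iota 0 M]])
    [set w | N i t w = 0%N]) w}.
  apply: block => [k|//|K]; first by rewrite size_map size_iota.
    by rewrite expR_gt0 -expR0 ler_expR; lra.
  by rewrite flattenE map_inj_uniq // iota_uniq.
apply: filterS => w [k Hk]; exists k => e eM; apply: Hk => /=.
by apply/mapP; exists e => //; rewrite mem_iota.
Qed.

End Poisson.
End Silence.

(** * Passing to extensions, and silent windows on the line *)

Section Transfer.
Variable R : realType.
Local Open Scope classical_set_scope.

Lemma mutually_independentS d (T : measurableType d) (P : probability T R)
    (I : choiceType) (G H : I -> set (set T)) :
  (forall i, H i `<=` G i) -> mutually_independent P G -> mutually_independent P H.
Proof. by move=> HG indep s A us HA; apply: indep => // i si; apply/HG/HA. Qed.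

Lemma ae_preimage d (T : measurableType d) (P : probability T R)
    d' (T' : measurableType d') (P' : probability T' R) (pi : T' -> T) (Q : T -> Prop) :
  measurable_fun setT pi -> (forall A, measurable A -> P' (pi @^-1` A) = P A) ->
  {ae P, forall w, Q w} -> {ae P', forall w, Q (pi w)}.
Proof.
move=> mpi Ppi [D [mD PD QD]]; exists (pi @^-1` D); split.
- by rewrite -[_ @^-1` _]setTI; exact: mpi.
- by rewrite Ppi.
- by move=> w; exact: QD.
Qed.

Lemma ae_forall_countable d (T : measurableType d) (P : probability T R)
    (I : countType) (Q : I -> T -> Prop) :
  (forall i, {ae P, forall w, Q i w}) -> {ae P, forall w, forall i, Q i w}.
Proof.
move=> aeQ.
have : {ae P, forall w, forall k : nat, if unpickle k is Some i then Q i w else True}.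
  apply: ae_foralln => k; case: (unpickle k) => [i|]; first exact: aeQ.
  exact: nearW.
by apply: filterS => w H i; have := H (pickle i); rewrite pickleK.
Qed.

Section SilentWindows.
Context d (T : measurableType d) (P : probability T R).
Variables (N : int -> R -> T -> nat) (G : set (set T)).
Hypothesis NP : forall i, poisson_process P (N i).
Hypothesis indep : mutually_independent P
  (fun o : option int => if o is Some i then sigma_process (N i) else G).

Lemma ae_silent : {ae P, forall w,
  forall i (S t : R), N i S w = 0%N -> t < S -> silent (fun i t => N i t w) t i}.
Proof.
have : {ae P, forall w, forall i, N i 0 w = 0%N /\
    forall s t, 0 <= s -> s <= t -> (N i s w <= N i t w)%N}.
  apply: ae_forall_countable => i; have [_ aeN _ _] := NP i.
  by apply: filterS aeN => w [].
apply: filterS => w Nw i S t NS tS u u0 ut ring.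
have [N0 Nmono] := Nw i.
by have := rings_pos Nmono N0 u0 (lt_trans ut tS) ring; rewrite NS.
Qed.

(** The sites from [- L] leftwards are cut into disjoint blocks of length [n.+2], the size of a
    silent window; on the right single sites suffice. Counts are taken at time [S.+1] because
    [ae_silent] asks for a strictly later time. *)
Lemma ae_silent_windows n : {ae P, forall w,
  (forall (S : nat) L, exists2 l, l <= L & silent_window n (fun i t => N i t w) S%:R l) /\
  (forall (S : nat) c, exists2 r, c <= r & silent (fun i t => N i t w) S%:R (r + 1))}.
Proof.
have block (f : nat -> nat -> int) M : (forall L, injective (f L)) ->
    {ae P, forall w, forall S L : nat, exists k, forall e, (e < M)%N ->
      N (f L (k * M + e)%N) S.+1%:R w = 0%N}.
  move=> finj; apply: ae_foralln => S; apply: ae_foralln => L.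
  by apply: (ae_silent_block NP indep) => //; rewrite ltr0n.
have finjl L : injective (fun e : nat => - L%:Z - e%:Z) by move=> e e'; lia.
have finjr L : injective (fun e : nat => L%:Z + 1 + e%:Z) by move=> e e'; lia.
apply: filterS3 ae_silent (block _ n.+2 finjl) (block _ 1%N finjr) => w sil left right.
have ltS (S : nat) : S%:R < S.+1%:R :> R by rewrite ltr_nat.
split=> [S L|S c].
  have [k Hk] := left S (absz L).
  (* The silent block has rightmost site [l + 1] and leftmost site [l - n]. *)
  exists (- (absz L)%:Z - (k * n.+2)%:Z - 1); first lia.
  move=> i li il; apply: (sil _ _ _ _ (ltS S)).
  have := Hk (absz (- (absz L)%:Z - (k * n.+2)%:Z - i)%R).
  set e := absz _; have eE : e%:Z = - (absz L)%:Z - (k * n.+2)%:Z - i by rewrite /e; lia.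
  rewrite (_ : - _ - _ = i); last by rewrite PoszD eE; lia.
  by apply; lia.
have [k Hk] := right S (absz c).
exists ((absz c)%:Z + k%:Z); first lia.
apply: (sil _ _ _ _ (ltS S)).
have := Hk 0%N isT; rewrite muln1 addn0.
by rewrite (_ : _ + 1 + _ = (absz c)%:Z + k%:Z + 1) //; lia.
Qed.

End SilentWindows.
End Transfer.

Theorem theorem4p1 (R : realType) (n : nat) :
  (forall (N : nat) (d : measure_display) (T : measurableType d)
      (P : probability T R) (x : R -> T -> mlstate 'I_N n),
    (0 < N)%N ->
    multilineZN P x ->
    {ae P, forall w, VZN_domain (x 0 w)} ->
    tasepZN P (fun t w => VZN (x t w) n)) /\
  (forall (d : measure_display) (T : measurableType d)
      (P : probability T R) (x : R -> T -> mlstate int n),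
    multilineZ P x ->
    {ae P, forall w, forall t : R, 0 <= t -> VZ_domain R (x t w)} ->
    tasepZ P (fun t w => VZ R (x t w) n)).
Proof.
split=> [N d T P x _ [mx [d' [T' [P' [pi [b [[mpi Ppi] bP indep drv]]]]]]] dom
        |d T P x [mx [d' [T' [P' [pi [b [[mpi Ppi] bP indep drv]]]]]]] _].
- split=> [t c e t0|]; first by apply: measurable_VZN => c' e'; exact: mx.
  exists d', T', P', pi, b; split=> //.
    apply: mutually_independentS indep => -[i|] //; apply: smallest_sub.
      exact: smallest_sigma_algebra.
    move=> _ [c [e ->]].
    (* Measurability is applied with the sigma-algebra generated by the initial state, so the
       initial image inherits independence from the bells. *)
    apply: (@measurable_VZN _ (g_sigma_algebraType [set A | exists c e,
      A = [set w | x 0 (pi w) c = e]]%classic) _ _ (fun w => x 0 (pi w))) => c' e'.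
    by apply: sub_sigma_algebra; exists c', e'.
  have dom' := ae_preimage mpi Ppi dom.
  by apply: filterS2 drv dom' => w drv_w dom_w; exact: driven_VZN.
- split=> [t c e t0|]; first by apply: measurable_VZ => c' e'; exact: mx.
  exists d', T', P', pi, b; split=> //.
    apply: mutually_independentS indep => -[i|] //; apply: smallest_sub.
      exact: smallest_sigma_algebra.
    move=> _ [c [e ->]].
    apply: (@measurable_VZ _ (g_sigma_algebraType [set A | exists c e,
      A = [set w | x 0 (pi w) c = e]]%classic) _ _ (fun w => x 0 (pi w))) => c' e'.
    by apply: sub_sigma_algebra; exists c', e'.
  have silence := ae_silent_windows bP indep n.
  by apply: filterS2 drv silence => w drv_w [left right]; exact: driven_VZ.
Qed.
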